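(* Let $\underline{\mathcal S}$ be the underlying manifold of the Lie group $\mathrm{Spin}(3)\ltimes\mathbb{R}^3$ of unit dual quaternions, and let $f$ be a continuous vector field defined on $\underline{\mathcal S}$. Then there exists no equilibrium point of $f$ that is globally asymptotically stable.
   Context: $\mathbb{H}$ denotes Hamilton's quaternions, with conjugate $\boldsymbol q^*$ and norm $\|\boldsymbol q\|=\sqrt{\boldsymbol q\boldsymbol q^*}$. Dual quaternions are the elements $\boldsymbol q+\varepsilon\boldsymbol q'$ with $\boldsymbol q,\boldsymbol q'\in\mathbb{H}$, where $\varepsilon\neq 0$ is a central symbol with $\varepsilon^2=0$; as a real vector space they are identified with $\mathbb{R}^8$. The set of unit dual quaternions is $$\underline{\mathcal S}=\{\boldsymbol q+\varepsilon\boldsymbol q' : \boldsymbol q,\boldsymbol q'\in\mathbb{H},\ \|\boldsymbol q\|=1,\ \boldsymbol q\boldsymbol q'^*+\boldsymbol q'\boldsymbol q^*=0\},$$ with the smooth structure as a submanifold of $\mathbb{R}^8$. Under dual quaternion multiplication it is a Lie group, denoted $\mathrm{Spin}(3)\ltimes\mathbb{R}^3$. An equilibrium point of $f$ is a zero of $f$. Global asymptotic stability is meant in the usual sense for $\dot x=f(x)$: the equilibrium is Lyapunov stable and all solutions, from every initial condition in $\underline{\mathcal S}$, converge to it as $t\to\infty$. *)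

(* Defs.v *)
From HB Require Import structures.
From mathcomp Require Import all_boot all_order all_algebra.
From mathcomp Require Import all_classical all_reals all_analysis.

Set Implicit Arguments.
Unset Strict Implicit.
Unset Printing Implicit Defensive.

Import Order.TTheory GRing.Theory Num.Theory.
Import numFieldNormedType.Exports.

Local Open Scope classical_set_scope.
Local Open Scope ring_scope.

Section Quaternions.
Variable R : realType.

(* (a, b, c, d) stands for a + b i + c j + d k. *)
Definition quaternion := 'rV[R]_4.

Definition quat (a b c d : R) : quaternion := \row_(j < 4) [:: a; b; c; d]`_j.

Definition qmul (p q : quaternion) : quaternion :=
  quat
    (p 0 0 * q 0 0 - p 0 1 * q 0 1 - p 0 2 * q 0 2 - p 0 3 * q 0 3)
    (p 0 0 * q 0 1 + p 0 1 * q 0 0 + p 0 2 * q 0 3 - p 0 3 * q 0 2)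
    (p 0 0 * q 0 2 - p 0 1 * q 0 3 + p 0 2 * q 0 0 + p 0 3 * q 0 1)
    (p 0 0 * q 0 3 + p 0 1 * q 0 2 - p 0 2 * q 0 1 + p 0 3 * q 0 0).

Definition qconj (q : quaternion) : quaternion :=
  quat (q 0 0) (- q 0 1) (- q 0 2) (- q 0 3).

(* q q^* is a real quaternion, so its real part carries all of it.  This is
   not the library norm `|q|, which is the maximum of the coordinates. *)
Definition qnorm (q : quaternion) : R := Num.sqrt (qmul q (qconj q) 0 0).

(* q + eps q' is the concatenation of the coordinates of q and of q'. *)
Definition dual_quaternion := 'rV[R]_(4 + 4).

Definition primal (x : dual_quaternion) : quaternion := lsubmx x.
Definition dual_part (x : dual_quaternion) : quaternion := rsubmx x.

Definition unit_dual_quaternions : set dual_quaternion :=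
  [set x | qnorm (primal x) = 1 /\
           qmul (primal x) (qconj (dual_part x)) +
           qmul (dual_part x) (qconj (primal x)) = 0].

End Quaternions.

Section VectorFields.
Variables (R : realType) (V : normedModType R).
Implicit Types (M : set V) (f : V -> V) (x y : R -> V) (b c : \bar R).

(* The tangent space at p of an embedded submanifold M of V: the velocities
   at time 0 of the smooth curves of M through p. *)
Definition tangent_space M (p : V) : set V :=
  [set v | exists (e : R) (g : R -> V),
     [/\ 0 < e,
         forall t, `|t| < e -> M (g t),
         forall n t, `|t| < e -> derivable (derive1n n g) t 1,
         g 0 = p & derive1 g 0 = v]].

(* Only the values of f on M matter; f is total for convenience. *)
Definition continuous_vector_field M f : Prop :=
  {within M, continuous f} /\ forall p, M p -> tangent_space M p (f p).

Definition equilibrium M f (p : V) : Prop := M p /\ f p = 0.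

(* The interval [0, b[, where b may be +oo. *)
Definition time_domain b : set R := [set t | 0 <= t /\ (t%:E < b)%E].

(* x solves x' = f(x) on [0, b[ and stays in M.  At t = 0 continuity is enough:
   the right derivative f (x 0) then exists since f is continuous. *)
Definition solution M f b x : Prop :=
  [/\ (0 < b)%E,
      {within time_domain b, continuous x},
      forall t, time_domain b t -> M (x t) &
      forall t, time_domain b t -> 0 < t -> is_derive t 1 x (f (x t))].

Definition maximal_solution M f b x : Prop :=
  solution M f b x /\
  forall c y, (b < c)%E -> solution M f c y ->
    ~ (forall t, time_domain b t -> y t = x t).

(* As f is only continuous, solutions need not be unique: every solution
   starting near p is required to stay near p. *)
Definition lyapunov_stable M f (p : V) : Prop :=
  forall e : R, 0 < e -> exists2 d : R, 0 < d &
    forall b x, solution M f b x -> `|x 0 - p| < d ->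
      forall t, time_domain b t -> `|x t - p| < e.

(* Every maximal solution exists for all positive times and converges to p;
   without maximality, restrictions to bounded intervals would be included,
   and without b = +oo, solutions escaping in finite time would be ignored. *)
Definition globally_attractive M f (p : V) : Prop :=
  forall b x, maximal_solution M f b x ->
    b = +oo%E /\ x t @[t --> +oo] --> p.

Definition globally_asymptotically_stable M f (p : V) : Prop :=
  lyapunov_stable M f p /\ globally_attractive M f p.

End VectorFields.

(* Main.v *)
(* The manifold M of unit dual quaternions consists of the pairs (q, q') of
   orthogonal quaternions with |q| = 1.  Dividing f by 1 + |f| only changes the
   speed along the orbits, so that p stays stable and attractive for the bounded
   field g = f / (1 + |f|), whose solutions are global.  By compactness, there is
   one time at which all the solutions of g that start in {|x| <= 1} are near p,
   and the same holds for Euler polygons with a small enough step.  An Euler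
   polygon depends continuously on its starting point, on its step size too, and
   its vertices can be projected to M.  Letting the step size decrease to 0, one
   deforms an almost constant map S^3 -> S^3 into the identity, hence obtains a
   map R^4 -> R^4 without zeros that is radial outside of the unit ball.  This
   contradicts the Poincare-Miranda theorem, which comes from a discrete Stokes
   formula for cup products, modulo 2, of coboundaries on a cubical grid. *)

Require Import Defs.
From mathcomp Require Import all_boot all_order all_algebra.
From mathcomp Require Import all_classical all_reals all_analysis.
From mathcomp Require Import zify ring lra.

Set Implicit Arguments.
Unset Strict Implicit.
Unset Printing Implicit Defensive.

Import Order.TTheory GRing.Theory Num.Theory.
Import numFieldNormedType.Exports.

Local Open Scope classical_set_scope.
Local Open Scope ring_scope.

(** * Cup products of coboundaries on a grid *)

Section CubicalCup.
Variables (K : comNzRingType) (n : nat).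
Hypothesis char2 : forall x : K, x + x = 0.
Notation vertex := ('I_n -> nat).
Implicit Types (z v : vertex) (a b : 'I_n) (S : {set 'I_n}) (s : seq 'I_n).
Implicit Types (F : vertex -> K).

Definition bump_at a z : vertex := fun j => (z j + (j == a))%N.
Definition setc a i z : vertex := fun j => if j == a then i else z j.

Lemma bump_atC a b z : bump_at a (bump_at b z) = bump_at b (bump_at a z).
Proof. by apply/funext => j; rewrite /bump_at addnAC. Qed.

(** The terms at [(a, b)] and [(b, a)] are equal and cancel in characteristic 2. *)
Lemma sum_offdiag0 S (F : 'I_n -> 'I_n -> K) :
  (forall a b, F a b = F b a) ->
  \sum_(a in S) \sum_(b in S :\ a) F a b = 0.
Proof.
move=> Fsym.
have F0 (a b : 'I_n) : F a b + F a b = 0 by [].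
rewrite (eq_bigr (fun a => \sum_(b in S | (b < a)%N) F a b +
                           \sum_(b in S | (a < b)%N) F a b)); last first.
  move=> a _; rewrite (bigID (fun b : 'I_n => (b < a)%N)) /=.
  congr (_ + _); apply: eq_bigl => b; rewrite !inE -(inj_eq val_inj) /=; lia.
rewrite big_split /=.
rewrite [X in X + _](exchange_big_dep (mem S)) /=; last first.
  by move=> a b _ /andP[].
rewrite -big_split big1 // => a aS.
transitivity (\sum_(b in S | (a < b)%N) (F a b + F a b)); last by apply: big1.
rewrite big_split; congr (_ + _); apply: eq_big => b //.
by rewrite aS.
Qed.

Variable u : 'I_n -> vertex -> K.

(* The value on the cube [z + {0,1}^S] of the cup product of the coboundaries
   of the functions [u a], [a] in [s]: a sum over the monotone edge paths from
   [z] to the opposite vertex. *)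
Fixpoint cup s z S : K :=
  if s is a :: s' then
    \sum_(b in S) (u a (bump_at b z) + u a z) * cup s' (bump_at b z) (S :\ b)
  else 1.

Lemma setD1C S a b : S :\ a :\ b = S :\ b :\ a.
Proof. by rewrite !finset.setDDl finset.setUC. Qed.

(** A cup product of cocycles is a cocycle: the sum over all facets of the cube, those through [z]
    and the opposite ones, is its coboundary modulo 2. *)
Lemma cup_closed s z S :
  \sum_(b in S) (cup s (bump_at b z) (S :\ b) + cup s z (S :\ b)) = 0.
Proof.
have oppK x : - x = x :> K by apply/eqP; rewrite eq_sym -addr_eq0 char2.
elim: s z S => [|c s IH] z S; first by rewrite big1.
have IH' z' S' : \sum_(b in S') cup s (bump_at b z') (S' :\ b) =
                 \sum_(b in S') cup s z' (S' :\ b).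
  by have /eqP := IH z' S'; rewrite big_split /= addr_eq0 oppK => /eqP.
rewrite /=.
pose D a b := cup s (bump_at b (bump_at a z)) (S :\ a :\ b).
have e1 : \sum_(a in S) \sum_(b in S :\ a) u c (bump_at b (bump_at a z)) * D a b = 0.
  by apply: sum_offdiag0 => a b; rewrite /D bump_atC setD1C.
(* [IH'] moves the base point back to [z], which makes the summand symmetric. *)
have e2 : \sum_(a in S) \sum_(b in S :\ a) cup s (bump_at b z) (S :\ a :\ b) = 0.
  rewrite (eq_bigr (fun a => \sum_(b in S :\ a) cup s z (S :\ a :\ b))) //.
    by apply: sum_offdiag0 => a b; rewrite setD1C.
have swap (F : 'I_n -> 'I_n -> K) :
    \sum_(a in S) \sum_(b in S :\ a) F a b = \sum_(a in S) \sum_(b in S :\ a) F b a.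
  apply: etrans (exchange_big_dep (mem S) _) _ => //=.
    by move=> a b _; rewrite inE => /andP[].
  by apply: eq_bigr => a aS; apply: eq_bigl => b; rewrite !inE aS (eq_sym a) andbC andbT.
transitivity (\sum_(a in S) \sum_(b in S :\ a) u c (bump_at a z) * D a b
   + \sum_(a in S) \sum_(b in S :\ a) u c (bump_at b z) * cup s (bump_at b z) (S :\ a :\ b)).
  transitivity (
     \sum_(a in S) \sum_(b in S :\ a) u c (bump_at b (bump_at a z)) * D a b +
     \sum_(a in S) \sum_(b in S :\ a) u c (bump_at a z) * D a b +
     (\sum_(a in S) \sum_(b in S :\ a) u c (bump_at b z) * cup s (bump_at b z) (S :\ a :\ b)
     + u c z * \sum_(a in S) \sum_(b in S :\ a) cup s (bump_at b z) (S :\ a :\ b))).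
    rewrite mulr_sumr -!big_split /=; apply: eq_bigr => a aS.
    rewrite mulr_sumr -!big_split /=; apply: eq_bigr => b bS.
    by rewrite !mulrDl.
  by rewrite e1 e2 add0r mulr0 addr0.
(* After the swap both sums carry the factor [u c (bump_at a z)]; the other factors add up to a
   coboundary based at [bump_at a z], zero by induction. *)
rewrite [X in _ + X]swap.
rewrite -big_split /= big1 // => a aS.
rewrite [X in _ + X](eq_bigr (fun b =>
  u c (bump_at a z) * cup s (bump_at a z) (S :\ a :\ b))); last first.
  by move=> b _; rewrite setD1C.
by rewrite -!mulr_sumr IH' char2.
Qed.

(** The cup product is exact, a coboundary of [u a] times the cup product of [s]. Adding [u a z]
    times the identity [cup_closed] turns each summand into a difference, modulo 2, of one function
    along an edge, ready for telescoping. *)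
Lemma cup_cons a s z S :
  cup (a :: s) z S = \sum_(b in S) (u a (bump_at b z) * cup s (bump_at b z) (S :\ b) +
                                    u a z * cup s z (S :\ b)).
Proof.
transitivity (cup (a :: s) z S +
   u a z * \sum_(b in S) (cup s (bump_at b z) (S :\ b) + cup s z (S :\ b))).
  by rewrite cup_closed mulr0 addr0.
rewrite /= mulr_sumr -big_split /=; apply: eq_bigr => b _.
by rewrite mulrDl mulrDr -addrA; congr (_ + _); rewrite addrA char2 add0r.
Qed.

(** The monotone paths stay in the cube, where the coboundary of [u a] vanishes on every edge. *)
Lemma cup_const c a s z S : a \in s ->
  (forall v, (forall j, (z j <= v j <= z j + (j \in S))%N) -> u a v = c) ->
  cup s z S = 0.
Proof.
elim: s z S => // d s IH z S; rewrite inE => /orP[/eqP<- uc|asin uc] /=;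
  apply: big1 => b bS.
  rewrite !uc ?char2 ?mul0r // => j; first by lia.
  by rewrite /bump_at; case: eqP => [->|_]; rewrite ?bS; lia.
rewrite IH ?mulr0 // => v vP; apply: uc => j.
have := vP j; rewrite /bump_at !inE; case: eqP => [->|_]; rewrite ?bS /=; lia.
Qed.

(** * Summation over the grid *)

Variable k : nat.

Fixpoint grid_sum s F z : K :=
  if s is a :: s' then \sum_(i < k) grid_sum s' F (setc a i z) else F z.

Lemma eq_grid_sum s F F' z : F =1 F' -> grid_sum s F z = grid_sum s F' z.
Proof. by move=> /funext->. Qed.

Lemma grid_sum_sum s S (F : 'I_n -> vertex -> K) z :
  grid_sum s (fun v => \sum_(b in S) F b v) z = \sum_(b in S) grid_sum s (F b) z.
Proof.
elim: s z => //= a s IH z; rewrite exchange_big; apply: eq_bigr => i _ /=.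
exact: IH.
Qed.

Lemma grid_sumD s F F' z :
  grid_sum s (fun v => F v + F' v) z = grid_sum s F z + grid_sum s F' z.
Proof.
by elim: s z => //= a s IH z; rewrite -big_split; apply: eq_bigr => i _ /=.
Qed.

Lemma grid_sum0 s z : grid_sum s (fun=> 0) z = 0.
Proof. by elim: s z => //= a s IH z; rewrite big1. Qed.

Lemma grid_sum_setc a i s F z : a \notin s ->
  grid_sum s F (setc a i z) = grid_sum s (F \o setc a i) z.
Proof.
elim: s z => //= b s IH z; rewrite inE negb_or => /andP[ab asn].
apply: eq_bigr => j _; rewrite -IH //; congr grid_sum; apply/funext => x.
by rewrite /setc; case: eqP => // ->; rewrite eq_sym (negbTE ab).
Qed.

(** Telescoping along [a]: modulo 2, each interior slice occurs twice. *)
Lemma grid_sum_bump a s F z : a \notin s ->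
  grid_sum (a :: s) (fun v => F (bump_at a v) + F v) z =
  grid_sum s F (setc a k z) + grid_sum s F (setc a 0 z).
Proof.
move=> asn /=; elim: k => [|m IH]; first by rewrite big_ord0 char2.
rewrite big_ord_recr /= IH grid_sumD.
have -> : grid_sum s (fun v => F (bump_at a v)) (setc a m z) =
          grid_sum s F (setc a m.+1 z).
  rewrite !grid_sum_setc //; apply: eq_grid_sum => v /=; congr F.
  by apply/funext => j; rewrite /bump_at /setc; case: eqP => _; lia.
rewrite addrC -addrA; congr (_ + _); rewrite addrA.
by rewrite char2 add0r.
Qed.

Lemma grid_sum_eq0 s F z :
  (forall v, (forall j, if j \in s then (v j < k)%N else v j == z j) -> F v = 0) ->
  grid_sum s F z = 0.
Proof.
elim: s z => [|a s IH] z F0 /=; first by apply: F0 => j /=.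
apply: big1 => i _; apply: IH => v vP; apply: F0 => j; have := vP j.
rewrite inE /setc; case: (j \in s); rewrite ?orbT // orbF.
by case: (j =P a) => // _ /eqP->.
Qed.

Hypothesis u0 : forall a v, v a = 0%N -> u a v = 0.
Hypothesis uk : forall a v, v a = k -> u a v = 1.

(** The cube lies in a face of the grid on which [u a] is constant. *)
Lemma cup_face0 a s v S : a \in s -> a \notin S -> v a = 0%N \/ v a = k ->
  cup s v S = 0.
Proof.
move=> asin aS [va|va]; [apply: (cup_const (c := 0) asin)|apply: (cup_const (c := 1) asin)].
  by move=> w /(_ a); rewrite va (negbTE aS) => wa; apply: u0; lia.
by move=> w /(_ a); rewrite va (negbTE aS) => wa; apply: uk; lia.
Qed.

Lemma grid_sum_bump0 a s F z : a \in s -> uniq s ->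
  (forall v, v a = 0%N \/ v a = k -> F v = 0) ->
  grid_sum s (fun v => F (bump_at a v) + F v) z = 0.
Proof.
move=> + + F0; elim: s z => // c s IH z; rewrite [_ \in _]inE.
have [<- _ /andP[asn _]|_ /= asin /andP[_ su]] := eqVneq a c; last first.
  by apply: big1 => i _; apply: IH.
rewrite grid_sum_bump // !grid_sum_setc // -grid_sumD.
rewrite -[RHS](grid_sum0 s z); apply: eq_grid_sum => v /=.
by rewrite !F0 ?addr0 // /setc eqxx; [left|right].
Qed.

(* Stokes' theorem: of the boundary terms only that on the face [v a = k], for
   [a] the head of [s], survives. *)
Lemma grid_sum_cup s z : uniq s ->
  grid_sum s (fun v => cup s v [set x in s]) z = 1.
Proof.
elim: s z => // a s IH z /[dup] asu /andP[asn su].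
set S := [set x in a :: s].
transitivity (\sum_(b in S) grid_sum (a :: s)
    (fun v => u a (bump_at b v) * cup s (bump_at b v) (S :\ b) +
              u a v * cup s v (S :\ b)) z).
  by rewrite -grid_sum_sum; apply: eq_grid_sum => v; exact: cup_cons.
rewrite (bigD1 a) ?inE ?eqxx //= [X in _ + X]big1 ?addr0; last first.
  move=> b /andP[bS ba].
  apply: (@grid_sum_bump0 b (a :: s) (fun v => u a v * cup s v (S :\ b))) => //.
    by move: bS; rewrite inE.
  move=> v vb; rewrite (@cup_face0 b) ?mulr0 // ?inE ?eqxx //.
  by move: bS; rewrite !inE (negbTE ba).
rewrite [LHS](@grid_sum_bump a s (fun v => u a v * cup s v (S :\ a))) //.
have -> : S :\ a = [set x in s].
  by apply/finset.setP => x; rewrite !inE; case: eqP => //= ->; rewrite (negbTE asn).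
rewrite !grid_sum_setc // [X in _ + X](_ : _ = 0) ?addr0; last first.
  rewrite -[RHS](grid_sum0 s z); apply: eq_grid_sum => v /=.
  by rewrite u0 ?mul0r // /setc eqxx.
rewrite -[RHS](IH (setc a k z) su) grid_sum_setc //; apply: eq_grid_sum => v /=.
by rewrite uk ?mul1r // /setc eqxx.
Qed.
End CubicalCup.

(** A cubical analogue of Sperner's lemma. For [u a] the indicator of [P a] modulo 2, the cup
    products over all cubes sum to 1, so one of them is nonzero; by [cup_const], no [P a] is
    constant on that cube. *)
Lemma mixed_cube (n k : nat) (P : 'I_n -> ('I_n -> nat) -> bool) :
  (forall a v, v a = 0%N -> ~~ P a v) -> (forall a v, v a = k -> P a v) ->
  exists z : 'I_n -> nat, (forall j, (z j < k)%N) /\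
    forall a, exists v w : 'I_n -> nat,
      [/\ forall j, (z j <= v j <= (z j).+1)%N,
          forall j, (z j <= w j <= (z j).+1)%N, P a v & ~~ P a w].
Proof.
move=> P0 Pk.
have char2 (x : 'F_2) : x + x = 0 by case: x => [[|[|]]] // ?; apply/val_inj.
pose u a v : 'F_2 := (P a v)%:R.
have u0 a v : v a = 0%N -> u a v = 0 by move=> /P0; rewrite /u => /negbTE->.
have uk a v : v a = k -> u a v = 1 by move=> /Pk; rewrite /u => ->.
have := @grid_sum_cup _ n char2 u k u0 uk (enum 'I_n) (fun=> 0%N) (enum_uniq _).
apply: contraPP => noz.
rewrite grid_sum_eq0; first by move=> /eqP; rewrite eq_sym oner_eq0.
move=> z zk; apply: contra_notP noz => cup_neq0; exists z; split=> [j|a].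
  by have := zk j; rewrite mem_enum.
apply: contra_notP cup_neq0 => noa.
have [vP|/existsNP[v /not_implyP[vz /negP vP]]] := pselect (forall v : 'I_n -> nat,
    (forall j, (z j <= v j <= (z j).+1)%N) -> P a v).
  apply: (cup_const char2 (a := a) (c := 1)); first by rewrite mem_enum.
  move=> v vz; rewrite /u vP // => j; have := vz j; lia.
apply: (cup_const char2 (a := a) (c := 0)); first by rewrite mem_enum.
move=> w wz; rewrite /u; case: (boolP (P a w)) => // Pw.
exfalso; apply: noa; exists w, v; split=> // j; have := wz j; lia.
Qed.

(** * The Poincare-Miranda theorem *)

Lemma compact_seq_cluster (R : realType) (V : normedModType R) (K : set V)
    (c : nat -> V) : compact K -> (forall n, K (c n)) ->
  exists2 x, K x & forall e N, 0 < e -> exists2 n, (N <= n)%N & `|c n - x| < e.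
Proof.
move=> Kc cK; have cK' : (c @ \oo) K by exists 0%N => // n _; exact: cK.
have [x [Kx xc]] := Kc (c @ \oo) _ cK'.
exists x => // e N e0.
have [] := xc [set y | exists2 n, (N <= n)%N & y = c n] (ball x e).
- by exists N => // n /= Nn; exists n.
- exact: nbhsx_ballx.
by move=> _ [[n Nn ->]]; rewrite -ball_normE /= distrC => ?; exists n.
Qed.

Lemma rV_norm_ltP (R : realType) n (x : 'rV[R]_n) e : 0 < e ->
  (`|x| < e) <-> (forall j, `|x 0 j| < e).
Proof.
move=> e0; rewrite [`|x|]mx_normrE; split => [/bigmax_ltP[_ H] j|H].
  exact: (H (0, j) isT).
by apply/bigmax_ltP; split=> // -[i j] _ /=; rewrite ord1.
Qed.

Lemma rV_norm_leP (R : realType) n (x : 'rV[R]_n) e : 0 <= e ->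
  (`|x| <= e) <-> (forall j, `|x 0 j| <= e).
Proof.
move=> e0; rewrite [`|x|]mx_normrE; split => [/bigmax_leP[_ H] j|H].
  exact: (H (0, j) isT).
by apply/bigmax_leP; split=> // -[i j] _ /=; rewrite ord1.
Qed.

Lemma coord_le_norm (R : realType) n (x : 'rV[R]_n) j : `|x 0 j| <= `|x|.
Proof. by move: j; apply/rV_norm_leP. Qed.

Lemma compact_closed_ball_rV (R : realType) n (r : R) :
  compact [set x : 'rV[R]_n | `|x| <= r].
Proof.
apply: bounded_closed_compact.
  by exists r; split; [exact: num_real|move=> M rM x /= /le_trans; apply; exact: ltW].
rewrite (_ : mkset _ = (fun x : 'rV[R]_n => `|x|) @^-1` [set y | y <= r]) //.
apply: preimage_closed; last exact: closed_le.
by move=> x _; exact: norm_continuous.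
Qed.

(** On ever finer grids, [mixed_cube] gives a small cube on whose vertices each component of [G]
    takes both weak signs; at a cluster point of these cubes all components vanish by continuity. *)
Lemma poincare_miranda (R : realType) n (G : 'rV[R]_n -> 'rV[R]_n) :
  continuous G ->
  (forall (x : 'rV[R]_n) j, `|x| <= 1 -> x 0 j = -1 -> G x 0 j <= 0) ->
  (forall (x : 'rV[R]_n) j, `|x| <= 1 -> x 0 j = 1 -> 0 <= G x 0 j) ->
  exists2 x : 'rV[R]_n, `|x| <= 1 & G x = 0.
Proof.
move=> Gc Gm Gp.
pose pt k (v : 'I_n -> nat) : 'rV[R]_n := \row_j (2 * (v j)%:R / k.+1%:R - 1).
have k0 k : (0 : R) < k.+1%:R by rewrite ltr0n.
have pt1 k v : (forall j, (v j <= k.+1)%N) -> `|pt k v| <= 1.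
  move=> vk; apply/rV_norm_leP => // j; rewrite mxE ler_norml.
  have vj : (v j)%:R <= k.+1%:R :> R by rewrite ler_nat.
  have : (v j)%:R / k.+1%:R <= 1 :> R by rewrite ler_pdivrMr ?mul1r.
  have : 0 <= (v j)%:R / k.+1%:R :> R by rewrite divr_ge0.
  by move=> v0 v1; rewrite -mulrA; apply/andP; split; set y := (_ / _) in v0 v1 *; lra.
(* The value is forced on the two opposite faces, where [G] has only a weak sign and may vanish;
   [PP] checks that this agrees with the weak signs. *)
pose P k a (v : 'I_n -> nat) :=
  (v a == k.+1) || (v a != 0%N) && (0 < G (pt k v) 0 a).
have PP k a v : (forall j, (v j <= k.+1)%N) ->
    if P k a v then 0 <= G (pt k v) 0 a else G (pt k v) 0 a <= 0.
  move=> /(pt1 k) v1; rewrite /P; have [va|_ /=] := eqVneq; last have [va|_ /=] := eqVneq.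
  - by apply: Gp => //; rewrite mxE va -mulrA divff ?gt_eqF // mulr1; lra.
  - by apply: Gm => //; rewrite mxE va mulr0 mul0r sub0r.
  - by case: ltP => // /ltW.
have cube k := @mixed_cube n k.+1 (P k) (fun a v va => ltac:(by rewrite /P va))
   (fun a v va => ltac:(by rewrite /P va eqxx)).
have [z zP] := choice cube.
have [|x x1 xc] := @compact_seq_cluster R _ _ (fun k => pt k (z k))
    (@compact_closed_ball_rV R n 1).
  by move=> k; apply: pt1 => j; have [/(_ j) + _] := zP k; lia.
exists x => //; apply/rowP => a; rewrite mxE.
have close (A : set R) : nbhs (G x 0 a) A -> exists k, forall v,
   (forall j, (z k j <= v j <= (z k j).+1)%N) -> A (G (pt k v) 0 a).
  move=> An.
  have : nbhs x (fun y => A (G y 0 a)).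
    apply: (@cvg_comp _ _ _ G (fun y : 'rV[R]_n => y 0 a) (nbhs x) (nbhs (G x))) An => //.
    + exact: Gc.
    + exact: coord_continuous.
  move=> /nbhs_ballP[e /= e0 eA].
  (* Half of [e] is for the side [2 / k.+1] of the cube, half for the distance from its corner to
     [x]. *)
  have [N _ NP] : \forall N \near \oo, (2 / N.+1%:R < e / 2).
    have e4 : 0 < e / 2 / 2 by rewrite !divr_gt0.
    near=> N; rewrite mulrC -ltr_pdivlMr //.
    by near: N; exact: (near_infty_natSinv_lt (PosNum e4)).
  have [|k Nk kx] := xc (e / 2) N; first by rewrite divr_gt0.
  exists k => v vz; apply: eA; rewrite -ball_normE /= distrC.
  have -> : pt k v - x = (pt k v - pt k (z k)) + (pt k (z k) - x) by rewrite addrA subrK.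
  rewrite (le_lt_trans (ler_normD _ _)) // [X in _ < X](splitr e) ltrD //.
  apply/rV_norm_ltP => [|j]; first by rewrite divr_gt0.
  apply: le_lt_trans (NP k Nk).
  rewrite !mxE opprB addrA subrK -mulrBl -mulrBr normrM normfV (gtr0_norm (k0 k)).
    rewrite ler_wpM2r ?invr_ge0 ?(ltW (k0 k)) // normrM (ger0_norm (_ : 0 <= 2)) //.
  rewrite -[leRHS]mulr1 ler_wpM2l // ler_norml.
  have /andP[a1 a2] := vz j.
  have : (z k j)%:R <= (v j)%:R :> R by rewrite ler_nat.
  have : (v j)%:R <= (z k j)%:R + 1 :> R by rewrite natr1 ler_nat.
  by move=> v1 v2; apply/andP; split; lra.
(* If [G x 0 a] were nonzero, its strict sign would hold on a whole mixed cube, against [w] or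
   [v]. *)
apply/eqP; rewrite eq_le; apply/andP; split; rewrite leNgt; apply/negP => Ga.
  have [k kP] := close _ (lt_nbhsr Ga).
  have [zk /(_ a)[v [w [vz wz vP wP]]]] := zP k.
  have := PP k a w; rewrite (negbTE wP) leNgt kP => [H|]; last exact: wz.
  by suff : ~~ true by []; apply: H => j; have := wz j; have := zk j; lia.
have [k kP] := close _ (lt_nbhsl Ga).
have [zk /(_ a)[v [w [vz wz vP wP]]]] := zP k.
have := PP k a v; rewrite vP leNgt kP => [H|]; last exact: vz.
by suff : ~~ true by []; apply: H => j; have := vz j; have := zk j; lia.
Unshelve. all: by end_near. Qed.

(** * Limits of approximate solutions *)

Section Solutions.
Variable R : realType.

Lemma is_derive_eps (V : normedModType R) (y : R -> V) (t : R) (v : V) :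
  (forall e : R, 0 < e -> exists2 d : R, 0 < d & forall s : R, `|s - t| < d ->
     `|y s - y t - (s - t) *: v| <= e * `|s - t|) ->
  is_derive t 1 y v.
Proof.
move=> H.
have yv : h^-1 *: ((y \o shift t) (h *: 1) - y t) @[h --> 0^'] --> v.
  apply/cvgrPdist_le => e e0; have [d d0 dP] := H e e0.
  rewrite near_withinE; apply/nbhs_ballP; exists d => // h.
  rewrite -ball_normE /= sub0r normrN => hd h0.
  have nh0 : 0 < `|h| by rewrite normr_gt0.
  have := dP (h + t); rewrite addrK => /(_ hd).
  rewrite [h *: 1]mulr1 -ler_pdivrMr // mulrC -normfV -normrZ scalerBr scalerA mulVf //.
  by rewrite scale1r distrC.
split; last exact: (cvg_lim _ yv).
by apply/cvg_ex; exists v.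
Qed.

Lemma within_continuous_epsP (V W : normedModType R) (M : set V) (g : V -> W) :
  {within M, continuous g} <->
  (forall p, M p -> forall e : R, 0 < e -> exists2 d : R, 0 < d &
     forall x, M x -> `|x - p| < d -> `|g x - g p| < e).
Proof.
rewrite subspace_continuousP; split=> H p Mp.
  move=> e e0; have /cvgrPdist_lt /(_ e e0) := H p Mp.
  rewrite near_withinE => /nbhs_ballP[d /= d0 dP]; exists d => // x Mx xp.
  by rewrite distrC; apply: dP => //; rewrite -ball_normE /= distrC.
apply/cvgrPdist_lt => e e0; have [d d0 dP] := H p Mp e e0.
rewrite near_withinE; apply/nbhs_ballP; exists d => // x; rewrite -ball_normE /= => xp Mx.
by rewrite distrC; apply: dP => //; rewrite distrC.
Qed.

(** An ultrafilter provides limits at all times at once, in place of a diagonal extraction. *)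
Lemma ultra_cvg_compact (I : Type) (T : topologicalType) (U : set_system I)
    (A : set T) (f : I -> T) :
  UltraFilter U -> compact A -> U (f @^-1` A) -> exists p : T, f x @[x --> U] --> p.
Proof.
move=> UU cA UA; have [p [_ pf]] := cA (f @ U) _ UA.
exists p => B pB; have [//|UB] := in_ultra_setVsetC (f @^-1` B) UU.
by have [x []] := pf (~` B) B UB pB.
Qed.

(* Solutions satisfy this with [eta = 0], by the mean value theorem, and so do
   Euler polygons, read as step functions, with a small [eta].  For [eta] going
   to 0, it passes to pointwise limits and makes the limit differentiable. *)
Definition approx_solution m (g : 'rV[R]_m -> 'rV[R]_m) eta (y : R -> 'rV[R]_m) :=
  forall s t v e, 0 <= s -> s <= t -> `|v| <= 1 -> 0 <= e ->
    (forall r, s <= r <= t -> `|g (y r) - v| <= e) ->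
    `|y t - y s - (t - s) *: v| <= (t - s + eta) * (e + eta) + eta.

Lemma approx_solution_lipschitz m (M : set 'rV[R]_m) g eta y s t :
  (forall x, M x -> `|g x| <= 1) -> (forall t, 0 <= t -> M (y t)) ->
  approx_solution g eta y -> 0 <= eta <= 1 -> 0 <= s -> 0 <= t ->
  `|y t - y s| <= 2 * `|t - s| + 3 * eta.
Proof.
move=> g1 My yg /andP[eta0 eta1].
wlog st : s t / s <= t => [hw|] s0 t0.
  have [|/ltW] := leP s t; first by move=> st; apply: hw.
  by move=> ts; rewrite distrC (distrC t); apply: hw.
(* Here [v = 0] and [e = 1], as [g] is bounded by 1 on [M]. *)
have := yg s t 0 1 s0 st; rewrite normr0 ler01 => /(_ isT isT).
rewrite scaler0 subr0 ger0_norm ?subr_ge0 // => H; apply: le_trans (H _) _.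
  by move=> r /andP[sr _]; rewrite subr0 g1 //; apply/My/(le_trans s0).
have : 0 <= (t - s) * (1 - eta) by rewrite mulr_ge0 ?subr_ge0.
have : 0 <= eta * (1 - eta) by rewrite mulr_ge0 ?subr_ge0.
move: (t - s) => a; lra.
Qed.

(** Compactness in the style of Peano's theorem: the pointwise limit along an ultrafilter satisfies
    the approximate inequality without error, and the continuity of [g] then gives the
    derivative. *)
Lemma limit_solution m (M K : set 'rV[R]_m) g (eta : nat -> R) (y : nat -> R -> 'rV[R]_m) :
  closed M -> {within M, continuous g} -> (forall x, M x -> `|g x| <= 1) ->
  compact K -> (forall n, K (y n 0)) -> (forall n t, 0 <= t -> M (y n t)) ->
  (forall n, 0 <= eta n <= 1) -> eta @ \oo --> 0 ->
  (forall n, approx_solution g (eta n) (y n)) ->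
  exists z, [/\ solution M g +oo%E z, K (z 0) &
    forall t e N, 0 <= t -> 0 < e -> exists2 n, (N <= n)%N & `|y n t - z t| < e].
Proof.
move=> Mcl gc g1 Kc Ky My eta01 eta_cvg ya.
have lip n s t : 0 <= s -> 0 <= t -> `|y n t - y n s| <= 2 * `|t - s| + 3 * eta n.
  by move=> s0 t0; apply: (@approx_solution_lipschitz _ M g) => //; exact: My.
have [U [UU ooU]] := ultraFilterLemma (eventually_filter : ProperFilter \oo).
have [C [_ KC]] := compact_bounded Kc.
(* [Num.max t 0] makes the statement hold for every real [t], as the choice of [z] requires. *)
have zex t : exists p : 'rV[R]_m, y n (Num.max t 0) @[n --> U] --> p.
  pose B := [set x : 'rV[R]_m | `|x| <= (C + 1) + (2 * `|Num.max t 0 - 0| + 3)].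
  have cB : compact B by exact: compact_closed_ball_rV.
  apply: (ultra_cvg_compact (f := fun n => y n (Num.max t 0)) UU cB).
  apply: ooU; exists 0%N => // n _; rewrite /B /preimage /mkset.
  have -> : y n (Num.max t 0) = y n 0 + (y n (Num.max t 0) - y n 0) by rewrite addrC subrK.
  rewrite (le_trans (ler_normD _ _)) // lerD //.
    by apply: KC; [rewrite ltrDl|exact: Ky].
  rewrite (le_trans (lip _ _ _ _ _)) ?le_max ?lexx ?orbT // lerD2l.
  by rewrite ler_piMr //; have /andP[] := eta01 n.
have [z zP] := choice zex.
have yz t : 0 <= t -> y n t @[n --> U] --> z t.
  by move=> t0; have := zP t; rewrite (max_idPl t0).
have eta_U : eta @ U --> 0 by apply: cvg_trans eta_cvg; exact: cvg_app.
have yzU t e : 0 <= t -> 0 < e -> \forall n \near U, `|y n t - z t| < e.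
  by move=> /yz /cvgrPdist_lt yt /yt; apply: filterS => n; rewrite distrC.
have etaU e : 0 < e -> \forall n \near U, eta n < e.
  move=> e0; have /cvgrPdist_lt/(_ e e0) := eta_U; apply: filterS => n.
  by rewrite sub0r normrN ger0_norm //; have /andP[] := eta01 n.
have Mz t : 0 <= t -> M (z t).
  move=> t0; apply: (@closed_cvg _ _ U _ (y ^~ t) M Mcl _ _ (yz t t0)).
  by apply: ooU; exists 0%N => // n _; exact: My.
(* The assumption bears on the [y n] and not on [z], so that no uniformity in [r] of the convergence
   is needed. *)
have zineq s t v e : 0 <= s -> s <= t -> `|v| <= 1 -> 0 <= e ->
    (\forall n \near U, forall r, s <= r <= t -> `|g (y n r) - v| <= e) ->
    `|z t - z s - (t - s) *: v| <= (t - s) * e.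
  move=> s0 st v1 e0 gU; apply/ler_addgt0Pr => e' e'0.
  (* As [eta n <= 1], the error terms are at most [eta n * c < e' / 2]; each end point costs
     [e' / 4]. *)
  pose c := t - s + e + 2.
  have c0 : 0 < c by rewrite /c; lra.
  have e4 : 0 < e' / 4 by rewrite divr_gt0.
  have ec : 0 < e' / 2 / c by rewrite !divr_gt0.
  have [n [[gn ytn] [ysn etan]]] := filter_ex
    (filterI (filterI gU (yzU t _ (le_trans s0 st) e4)) (filterI (yzU s _ s0 e4) (etaU _ ec))).
  have := ya n s t v e s0 st v1 e0 gn.
  have /andP[h0 h1] := eta01 n.
  move: etan; rewrite ltr_pdivlMr // => etan yan.
  have -> : z t - z s - (t - s) *: v =
     (y n t - y n s - (t - s) *: v) - (y n t - z t) + (y n s - z s).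
    by apply/rowP => j; rewrite !mxE; ring.
  apply: le_trans (ler_normD _ _) _.
  have := ler_normB (y n t - y n s - (t - s) *: v) (y n t - z t).
  have : 0 <= eta n * (1 - eta n) by rewrite mulr_ge0 ?subr_ge0.
  move: etan yan ysn ytn; rewrite /c.
  set A := `|_|; set B := `|_|; set D := `|_|; set E := `|_|.
  move: (eta n) (t - s) A B D E => h w A B D E; lra.
have zlip s t : 0 <= s -> s <= t -> `|z t - z s| <= t - s.
  move=> s0 st; have := zineq s t 0 1 s0 st.
  rewrite normr0 ler01 scaler0 subr0 mulr1; apply => //.
  apply: ooU; exists 0%N => // n _ r /andP[sr _]; rewrite subr0.
  by apply/g1/My/(le_trans s0).
exists z; split; last first.
- move=> t e N t0 e0.
  have UN : \forall n \near U, (N <= n)%N by apply: ooU; exists N.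
  by have [n [Nn yn]] := filter_ex (filterI UN (yzU t e t0 e0)); exists n.
- have Kcl : closed K by apply: compact_closed => //; exact: norm_hausdorff.
  apply: (@closed_cvg _ _ U _ (y ^~ 0) K Kcl _ _ (yz 0 (lexx _))).
  by apply: ooU; exists 0%N => // n _; exact: Ky.
split=> //.
- apply/within_continuous_epsP => p [p0 _] e e0; exists e => // x [x0 _] xp.
  apply: le_lt_trans xp; have [px|/ltW xp] := leP p x.
    by rewrite [leRHS]ger0_norm ?subr_ge0 //; exact: zlip.
  by rewrite distrC [leRHS]distrC [leRHS]ger0_norm ?subr_ge0 //; exact: zlip.
- by move=> t [t0 _]; exact: Mz.
move=> t [t0 _] tgt0; apply: is_derive_eps => e e0.
have [d d0 dP] := (within_continuous_epsP M g).1 gc _ (Mz t t0) e e0.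
(* For [eta n < d / 9], the Lipschitz bound gives [2 * (d / 6) + 3 * (d / 9)], and [y n t] is within
   [d / 3] of [z t]: the total is [d]. *)
exists (Num.min t (d / 6)) => [|s]; first by rewrite lt_min tgt0 divr_gt0.
rewrite lt_min => /andP[st sd].
have s0 : 0 <= s by move: st; rewrite ltr_norml; lra.
have key : \forall n \near U, forall r, 0 <= r -> `|r - t| <= `|s - t| ->
    `|g (y n r) - g (z t)| <= e.
  have d9 : 0 < d / 9 by rewrite divr_gt0.
  have d3 : 0 < d / 3 by rewrite divr_gt0.
  apply: filterS (filterI (yzU t _ t0 d3) (etaU _ d9)) => n [ytn etan] r r0 rs.
  apply/ltW/dP; first exact: My.
  have := lip n t r t0 r0; have := ler_normD (y n r - y n t) (y n t - z t).
  rewrite addrA subrK; move: rs sd ytn etan.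
  set A := `|_|; set B := `|_|; set D := `|_|; set E := `|_|; lra.
have [ts|/ltW ts] := leP t s.
  rewrite [in leRHS]ger0_norm ?subr_ge0 // mulrC; apply: zineq => //.
  - exact: g1 (Mz _ _).
  - exact: ltW.
  apply: filterS key => n nP r /andP[tr rs]; apply: nP; first exact: le_trans tr.
  by rewrite !ger0_norm ?subr_ge0 // lerD2r.
(* For [s < t], the same estimate on [[s, t]], up to sign, handles the left derivative. *)
have -> : z s - z t - (s - t) *: g (z t) = - (z t - z s - (t - s) *: g (z t)).
  by apply/rowP => j; rewrite !mxE; ring.
rewrite normrN [in leRHS]distrC [in leRHS]ger0_norm ?subr_ge0 // mulrC; apply: zineq => //.
- exact: g1 (Mz _ _).
- exact: ltW.
apply: filterS key => n nP r /andP[sr rt]; apply: nP; first exact: le_trans sr.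
by rewrite !ler0_norm ?subr_le0 // lerN2 lerD2r.
Qed.
End Solutions.

(** * Change of time *)

Section TimeChange.
Variables (R : realType) (m : nat).
Implicit Types (M : set 'rV[R]_m) (f g : 'rV[R]_m -> 'rV[R]_m).

Lemma is_derive_rVP (y : R -> 'rV[R]_m) (t : R) (v : 'rV[R]_m) :
  is_derive t 1 y v <-> forall j, is_derive t 1 (fun s => y s 0 j) (v 0 j).
Proof.
split=> [[yd yv] j|H].
  split; first by move/derivable_mxP : yd.
  by rewrite -yv derive_mx // mxE.
have yd : derivable y t 1 by apply/derivable_mxP => i j; rewrite ord1; have [] := H j.
split=> //; rewrite derive_mx //; apply/rowP => j; rewrite mxE.
by have [] := H j.
Qed.

(** The mean value theorem is applied to each coordinate, with its own intermediate time; this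
    suffices because the norm is the maximum of the coordinates. *)
Lemma solution_approx M g y : solution M g +oo%E y -> approx_solution g 0 y.
Proof.
move=> [_ yc My yd] s t v e s0; rewrite le_eqVlt => /predU1P[<- _ e0 _|st v1 e0 ge].
  by rewrite !subrr scale0r subr0 normr0 !add0r mul0r addr0.
rewrite !addr0; apply/rV_norm_leP => [|j]; first by rewrite mulr_ge0 // subr_ge0 ltW.
rewrite !mxE.
have [] := @MVT R (fun r => y r 0 j) (fun r => g (y r) 0 j) s t st.
- move=> r; rewrite in_itv /= => /andP[sr rt].
  have r0 := le_lt_trans s0 sr.
  have rdom : time_domain +oo%E r by split; [exact: ltW|exact: ltry].
  exact: ((is_derive_rVP y r (g (y r))).1 (yd r rdom r0) j).
- apply/within_continuous_epsP => r; rewrite /= in_itv /= => /andP[sr rt] e' e'0.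
  have [|d d0 dP] := (within_continuous_epsP _ _).1 yc r _ e' e'0.
    by split; [exact: le_trans sr|exact: ltry].
  exists d => // x; rewrite /= in_itv /= => /andP[sx _] xr.
  apply: le_lt_trans (dP x _ xr); last by split; [exact: le_trans sx|exact: ltry].
  by have := coord_le_norm (y x - y r) j; rewrite !mxE.
move=> c; rewrite in_itv /= => /andP[/ltW sc /ltW ct] ->.
rewrite [_ * (t - s)]mulrC -mulrBr normrM gtr0_norm ?subr_gt0 //.
rewrite ler_wpM2l ?subr_ge0 ?(ltW st) //.
have gc : `|g (y c) - v| <= e by apply: ge; rewrite sc ct.
by apply: le_trans gc; have := coord_le_norm (g (y c) - v) j; rewrite !mxE.
Qed.

(** Integrating from -1 makes 0 an interior point, so that the derivative there is two-sided. *)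
Lemma ex_primitive (a : R -> R) : continuous a ->
  exists2 S : R -> R, S 0 = 0 & forall t : R, -1 < t -> is_derive t 1 S (a t).
Proof.
move=> ac.
pose F (t : R) : R :=
  \int[lebesgue_measure]_(r in [set` Interval (BLeft (-1 : R)) (BRight t)]) a r.
exists (fun t => F t - F 0) => [|t t1]; first by rewrite subrr.
have tt : t < t + 1 by rewrite ltrDl.
have [] := @continuous_FTC1 R a (BLeft (-1)) t (t + 1) tt _ _ (ac t).
- apply: continuous_compact_integrable; first exact: segment_compact.
  by apply: continuous_subspaceT.
- by rewrite lte_fin.
move=> Fd; rewrite derive1E => Fa.
have FF : is_derive t 1 F (a t) by split.
rewrite -[a t]subr0.
exact: is_deriveB.
Qed.

Definition rescale f (x : 'rV[R]_m) := (1 + `|f x|)^-1 *: f x.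

Lemma rescale_factor_gt0 f x : 0 < (1 + `|f x|)^-1.
Proof. by rewrite invr_gt0 ltr_pwDl. Qed.

Lemma rescale_le1 f x : `|rescale f x| <= 1.
Proof.
rewrite normrZ gtr0_norm ?rescale_factor_gt0 // mulrC ler_pdivrMr ?ltr_pwDl //.
by rewrite mul1r lerDr.
Qed.

(* [S] is the primitive of [1 / (1 + `|f (y t)|)] and [x = y \o S^-1]. *)
Lemma time_change M f y : {within M, continuous f} ->
  solution M (rescale f) +oo%E y ->
  exists (b : \bar R) (x : R -> 'rV[R]_m) (S : R -> R),
    [/\ solution M f b x,
        forall t, 0 <= t -> time_domain b (S t) /\ x (S t) = y t,
        forall c, (c%:E < b)%E -> exists2 t : R, 0 <= t & c < S t,
        S 0 = 0 &
        forall t u, 0 <= t -> t < u -> exists2 c : R, t < c < u &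
          S u - S t = (1 + `|f (y c)|)^-1 * (u - t)].
Proof.
move=> fc [_ yc My yd].
(* [y] is controlled at nonnegative times only; [Num.max] makes the integrand continuous on the
   whole line. *)
pose a (t : R) : R := (1 + `|f (y (Num.max t 0))|)^-1.
have a_gt0 (t : R) : 0 < a t by exact: rescale_factor_gt0.
have y0c (t : R) : 0 <= t -> forall e : R, 0 < e -> exists2 d : R, 0 < d &
    forall s : R, 0 <= s -> `|s - t| < d -> `|y s - y t| < e.
  move=> t0 e e0; have tdom : time_domain +oo%E t by split=> //; exact: ltry.
  have [d d0 dP] := (within_continuous_epsP _ _).1 yc t tdom e e0.
  by exists d => // s s0 sd; apply: dP => //; split=> //; exact: ltry.
have ac : continuous a.
  move=> t; apply: cvgV; first by rewrite gt_eqF // ltr_pwDl.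
  apply: cvgD; first exact: cvg_cst.
  apply: cvg_norm; apply/cvgrPdist_lt => e e0.
  have t0 : 0 <= Num.max t 0 by rewrite le_max lexx orbT.
  have Mt : M (y (Num.max t 0)) by apply: My; split=> //; exact: ltry.
  have [d d0 dP] := (within_continuous_epsP _ _).1 fc _ Mt e e0.
  have [d' d'0 d'P] := y0c _ t0 d d0.
  apply/nbhs_ballP; exists d' => // s ts; have {}ts : `|t - s| < d' by exact: ts.
  have s0 : 0 <= Num.max s 0 by rewrite le_max lexx orbT.
  rewrite distrC; apply: dP; first by apply: My; split=> //; exact: ltry.
  apply: d'P => //; apply: le_lt_trans ts; rewrite distrC.
  have [h1|h1] := leP t 0; have [h2|h2] := leP s 0.
  - by rewrite subrr normr0.
  - by rewrite sub0r normrN gtr0_norm // ler_normr; apply/orP; right; lra.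
  - by rewrite subr0 gtr0_norm // ler_normr; apply/orP; left; lra.
  - by [].
have [S S0 Sd] := ex_primitive ac.
have Smvt (t u : R) : -1 < t -> t < u -> exists2 c : R, t < c < u & S u - S t = a c * (u - t).
  move=> t1 tu; have [||c ctu ->] := @MVT R S a t u tu.
  - by move=> r; rewrite in_itv /= => /andP[tr _]; apply: Sd; exact: lt_trans tr.
  - apply: derivable_within_continuous => r; rewrite in_itv /= => /andP[tr _].
    by have [] := Sd r (lt_le_trans t1 tr).
  by exists c => //; move: ctu; rewrite in_itv.
have Sinc (t u : R) : -1 < t -> t < u -> S t < S u.
  move=> t1 tu; have [c _ SE] := Smvt t u t1 tu.
  by rewrite -subr_gt0 SE mulr_gt0 // subr_gt0.
have Sinj (t u : R) : -1 < t -> -1 < u -> S t = S u -> t = u.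
  move=> t1 u1 tu; have [h|h|//] := ltgtP t u.
    by have := Sinc t u t1 h; rewrite tu ltxx.
  by have := Sinc u t u1 h; rewrite tu ltxx.
have m10 : -1 < 0 :> R by lra.
have gem1 (t : R) : 0 <= t -> -1 < t by lra.
(* The duration of the orbit under [f], possibly finite. *)
pose b := ereal_sup [set (S t)%:E | t in [set t : R | 0 <= t]].
have bgt (c : R) : (c%:E < b)%E -> exists2 t : R, 0 <= t & c < S t.
  by move=> /ereal_sup_gt[_ [t t0 <-]]; rewrite lte_fin; exists t.
(* The inverse of [S] on []-1, +oo[], with default value 0 off the range. *)
pose theta (r : R) : R := xget 0 [set t | -1 < t /\ S t = r].
have thetaK (t : R) : -1 < t -> theta (S t) = t.
  move=> t1; rewrite /theta; case: xgetP => [u _ [u1 us]|/(_ t)]; first exact: Sinj.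
  by case.
have Sdom (t : R) : 0 <= t -> time_domain b (S t).
  move=> t0; split.
    move: t0; rewrite le_eqVlt => /predU1P[<-|t0]; first by rewrite S0.
    by rewrite -S0 ltW // Sinc.
  have tt : t < t + 1 by rewrite ltrDl.
  apply: (@lt_le_trans _ _ (S (t + 1))%:E); first by rewrite lte_fin Sinc // gem1.
  by apply: ereal_sup_ubound; exists (t + 1) => //=; rewrite addr_ge0.
have Ssurj (r : R) : time_domain b r -> exists2 t : R, 0 <= t & S t = r.
  move=> [r0 /bgt[u u0 ru]].
  have [||t] := @IVT R S 0 u r u0.
  - apply: derivable_within_continuous => s; rewrite in_itv /= => /andP[s0 _].
    by have [] := Sd s (gem1 s s0).
  - by rewrite S0 ge_min r0 le_max (ltW ru) orbT.
  by rewrite in_itv /= => /andP[t0 _] tr; exists t.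
have theta_d (t : R) : -1 < t -> is_derive (S t) 1 theta (a t)^-1.
  move=> t1; apply: (@is_derive_inverse R S); last 2 first.
  - exact: Sd.
  - by rewrite gt_eqF.
  - near=> s; apply: thetaK; near: s; exact: lt_nbhsr.
  near=> s; have s1 : -1 < s by near: s; exact: lt_nbhsr.
  by apply: differentiable_continuous; apply/derivable1_diffP; have [] := Sd s s1.
exists b, (y \o theta), S; split=> //.
- split.
  + by have [] := Sdom 0 (lexx _); rewrite S0.
  + apply/within_continuous_epsP => r /Ssurj[t t0 <-] e e0 /=.
    rewrite thetaK ?gem1 //.
    have [d d0 dP] := y0c t t0 e e0.
    have thc : {for S t, continuous theta}.
      apply: differentiable_continuous; apply/derivable1_diffP.
      by have [] := theta_d t (gem1 t t0).
    have /cvgrPdist_lt/(_ d d0)/nbhs_ballP[d' /= d'0 d'P] := thc.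
    exists d' => // x /Ssurj[u u0 <-] ud; rewrite thetaK ?gem1 //; apply: dP => //.
    have := d'P (S u); rewrite !thetaK ?gem1 // distrC; apply.
    by move: ud; rewrite distrC.
  + by move=> r /Ssurj[t t0 <-] /=; rewrite thetaK ?gem1 //; apply: My; split=> //; exact: ltry.
  move=> r /Ssurj[t t0 <-] /=; rewrite -{1}S0 thetaK ?gem1 // => St.
  have {}t0 : 0 < t.
    by rewrite lt_neqAle t0 andbT; apply: contraTN St => /eqP<-; rewrite S0 ltxx.
  have tdom : time_domain +oo%E t by split; [exact: ltW|exact: ltry].
  apply/is_derive_rVP => j.
  have := (is_derive_rVP y t _).1 (yd t tdom t0) j.
  have th := theta_d t (gem1 t (ltW t0)).
  rewrite -{1}(thetaK t (gem1 t (ltW t0))) => yt.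
  (* The chain rule multiplies [rescale f] by the derivative of [theta], which is the inverse of the
     scaling factor; this gives back [f]. *)
  have := is_derive1_comp yt th.
  rewrite !mxE /a (max_idPl (ltW t0)) invrK mulrAC mulVf ?mul1r // gt_eqF // ltr_pwDl.
- by move=> t t0; split; [exact: Sdom|rewrite /= thetaK // gem1].
move=> t u t0 tu; have [c /andP[tc cu] SE] := Smvt t u (gem1 t t0) tu.
exists c; first by rewrite tc cu.
by rewrite SE /a (max_idPl _) // (le_trans t0) // ltW.
Unshelve. all: by end_near. Qed.
End TimeChange.

Section Rescaled.
Variables (R : realType) (m : nat).
Implicit Types (M : set 'rV[R]_m) (f g : 'rV[R]_m -> 'rV[R]_m).

Lemma solution_translate M g y (t0 : R) : 0 <= t0 ->
  solution M g +oo%E y -> solution M g +oo%E (fun t => y (t0 + t)).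
Proof.
move=> t00 [_ yc My yd].
have dom (t : R) : time_domain +oo%E t -> time_domain +oo%E (t0 + t).
  by move=> [t1 _]; split; [exact: addr_ge0|exact: ltry].
split=> //.
- apply/within_continuous_epsP => t td e e0.
  have [d d0 dP] := (within_continuous_epsP _ _).1 yc _ (dom t td) e e0.
  exists d => // s sd st; apply: dP; first exact: dom.
  by rewrite opprD addrACA subrr add0r.
- by move=> t /dom; exact: My.
move=> t td t_gt0; apply/is_derive_rVP => j.
have := (is_derive_rVP y _ _).1 (yd _ (dom t td) (ltr_wpDl t00 t_gt0)) j.
have ht : is_derive t 1 (fun s : R => t0 + s) 1.
  by rewrite -[X in is_derive _ _ _ X]add0r; apply: is_deriveD.
by move=> /is_derive1_comp/(_ ht); rewrite mulr1.
Qed.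

(** A change of speed keeps the orbits, hence stability. Translating [y] in time lets it start at
    any [t]. *)
Lemma rescale_stable M f p : {within M, continuous f} -> lyapunov_stable M f p ->
  forall e : R, 0 < e -> exists2 d : R, 0 < d &
    forall y, solution M (rescale f) +oo%E y -> forall t u, 0 <= t -> t <= u ->
    `|y t - p| < d -> `|y u - p| < e.
Proof.
move=> fc st e e0; have [d d0 dP] := st e e0; exists d => // y ysol t u t0 tu ytp.
have [b [x [S [xsol xS _ S0 _]]]] := time_change fc (solution_translate t0 ysol).
have [_ x0] := xS 0 (lexx _); rewrite S0 addr0 in x0.
have ut : 0 <= u - t by rewrite subr_ge0.
have [Sdom xSu] := xS _ ut.
have -> : y u = x (S (u - t)) by rewrite xSu addrC subrK.
by apply: (dP b x) => //; rewrite x0.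
Qed.

(* If [x] could be extended beyond a finite [b], then [f] would be bounded along
   [x] near [b], and [S] would grow at least linearly, hence exceed [b]. *)
Lemma rescale_attractive M f p : {within M, continuous f} -> globally_attractive M f p ->
  forall y, solution M (rescale f) +oo%E y ->
  forall e : R, 0 < e -> exists2 t, 0 <= t & `|y t - p| < e.
Proof.
move=> fc att y ysol e e0.
have [b [x [S [xsol xS Ssup S0 Smvt]]]] := time_change fc ysol.
have Smono t u : 0 <= t -> t < u -> S t < S u.
  move=> t0 tu; have [c _ SE] := Smvt t u t0 tu.
  by rewrite -subr_gt0 SE mulr_gt0 ?rescale_factor_gt0 // subr_gt0.
have [xmax|] := pselect (maximal_solution M f b x).
  have [bE xp] := att b x xmax; rewrite bE in Ssup.
  have /cvgrPdist_lt/(_ e e0)[A [_ AP]] := xp.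
  have [t t0 At] := Ssup A (ltry _); exists t => //.
  by have [_ <-] := xS t t0; rewrite distrC; exact: AP.
move=> /not_andP[//|] /existsNP[c] /existsNP[z] /not_implyP[bc] /not_implyP[[_ zc Mz _]].
move=> /contrapT zx; exfalso.
have [b0 _ _ _] := xsol.
case: b b0 bc xsol xS Ssup zx => [r| |] // r0 rc xsol xS Ssup zx; last first.
  by move: rc; rewrite ltNge leey.
have rdom : time_domain c r by split=> //; rewrite -lee_fin ltW.
have [d1 d10 d1P] := (within_continuous_epsP _ _).1 fc _ (Mz r rdom) 1 ltr01.
have [d d0 dP] := (within_continuous_epsP _ _).1 zc r rdom d1 d10.
pose C := `|f (z r)| + 2.
have C0 : 0 < C by rewrite ltr_wpDl.
have [t t0 St] : exists2 t : R, 0 <= t & r - d < S t.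
  by apply: Ssup; rewrite lte_fin ltrBlDr ltrDl.
have Sr u : 0 <= u -> S u < r by move=> /xS[[_ +] _]; rewrite lte_fin.
have fC u : t <= u -> (1 + `|f (y u)|) <= C.
  move=> tu; have u0 : 0 <= u := le_trans t0 tu.
  have Stu : S t <= S u by move: tu; rewrite le_eqVlt => /predU1P[->//|/(Smono _ _ t0)/ltW].
  have [Sdom <-] := xS u u0; rewrite -zx //.
  have Sc : time_domain c (S u) by case: Sdom => a Sur; split=> //; exact: lt_trans rc.
  have fz : `|f (z (S u)) - f (z r)| < 1.
    apply: d1P; first exact: Mz.
    apply: dP => //; rewrite ltr_norml; have := Sr u u0; move: St Stu; lra.
  have := ler_normD (f (z (S u)) - f (z r)) (f (z r)); rewrite subrK /C; lra.
(* [S] grows at rate at least [1 / C] from [t] on, so it gains at least [d] in this time and passes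
   [r], against [Sr]. *)
pose h := d * C.
have h0 : 0 < h by rewrite mulr_gt0.
have [v /andP[tv _] SE] := Smvt t (t + h) t0 (ltr_pwDr h0 (lexx t)).
have : d <= S (t + h) - S t.
  rewrite SE addrAC subrr add0r mulrC ler_pdivlMr ?ltr_pwDl // /h.
  by rewrite ler_wpM2l ?(ltW d0) // fC // ltW.
have := Sr (t + h) (addr_ge0 t0 (ltW h0)); lra.
Qed.
End Rescaled.

(** * Uniform attraction *)

Section UniformAttraction.
Variables (R : realType) (m : nat).
Variables (M K : set 'rV[R]_m) (f : 'rV[R]_m -> 'rV[R]_m) (p : 'rV[R]_m).
Hypotheses (Mcl : closed M) (fc : {within M, continuous f}).
Hypotheses (stable : lyapunov_stable M f p) (attractive : globally_attractive M f p).
Hypotheses (Kc : compact K) (KM : K `<=` M).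
Let g := rescale f.

Lemma rescale_continuous : {within M, continuous g}.
Proof.
apply/subspace_continuousP => x Mx.
have fx := (subspace_continuousP M f).1 fc x Mx.
apply: cvgZ => //; apply: cvgV; first by rewrite gt_eqF // ltr_pwDl.
by apply: cvgD; [exact: cvg_cst|exact: cvg_norm].
Qed.

(** Otherwise some [y N] is still far from [p] at time [N], for each [N]. A limit solution [z] comes
    close to [p] at some time [t], hence so does [y n] for some [n >= t], and stability keeps [y n]
    near [p] up to time [n]. *)
Lemma uniform_attraction (e : R) : 0 < e ->
  exists N : nat, forall y, solution M g +oo%E y -> K (y 0) -> `|y N%:R - p| < e.
Proof.
move=> e0; apply: contrapT => /forallNP noN.
have /choice[y yP] : forall N : nat, exists y, [/\ solution M g +oo%E y, K (y 0) &
    ~ `|y N%:R - p| < e].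
  move=> N; have /existsNP[y /not_implyP[ysol /not_implyP[yK yp]]] := noN N.
  by exists y.
have [z [zsol Kz yz]] : exists z, [/\ solution M g +oo%E z, K (z 0) &
    forall (t e : R) N, 0 <= t -> 0 < e -> exists2 n, (N <= n)%N & `|y n t - z t| < e].
  apply: (@limit_solution R m M K g (fun=> 0)) => //.
  - exact: rescale_continuous.
  - by move=> x _; exact: rescale_le1.
  - by move=> n; have [] := yP n.
  - by move=> n t t0; have [[_ _ My _] _ _] := yP n; apply: My; split=> //; exact: ltry.
  - by move=> n; rewrite lexx ler01.
  - exact: cvg_cst.
  - by move=> n; have [ysol _ _] := yP n; exact: (solution_approx ysol).
have [d d0 dP] := rescale_stable fc stable e0.
have d2 : 0 < d / 2 by rewrite divr_gt0.
have [t t0 zt] := rescale_attractive fc attractive zsol d2.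
have [n Nn ytz] := yz t (d / 2) (Num.truncn t).+1 t0 d2.
have [ysol _] := yP n; apply; apply: (dP _ ysol t) => //.
  by rewrite (le_trans (ltW (truncnS_gt t))) // ler_nat.
rewrite -[y n t](subrK (z t)) -addrA (le_lt_trans (ler_normD _ _)) //.
by rewrite [ltRHS]splitr ltrD.
Qed.

(** * One-step schemes with a second-order local error *)

Variables (E : R -> 'rV[R]_m -> 'rV[R]_m) (C : nat).
Hypothesis ME : forall h x, 0 <= h <= 1 -> M x -> M (E h x).
Hypothesis Eg : forall h x, 0 <= h <= 1 -> M x ->
  `|E h x - x - h *: g x| <= C%:R * h ^+ 2.

Lemma iter_step_in h x k : 0 <= h <= 1 -> M x -> M (iter k (E h) x).
Proof. by move=> h01 Mx; elim: k => //= k IH; apply: ME. Qed.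

(** Each step adds at most [h * e], from the variation of [g], and [C * h ^ 2], from the local
    error. *)
Lemma iter_step_near h x v e k : 0 <= h <= 1 -> M x ->
  (forall i, (i < k)%N -> `|g (iter i (E h) x) - v| <= e) ->
  `|iter k (E h) x - x - (k%:R * h) *: v| <= k%:R * h * (e + C%:R * h).
Proof.
move=> h01 Mx; elim: k => [|k IH] gk.
  by rewrite !mul0r scale0r !subrr normr0.
have h0 : 0 <= h by have /andP[] := h01.
set X := iter k (E h) x.
have -> : iter k.+1 (E h) x - x - (k.+1%:R * h) *: v =
   (X - x - (k%:R * h) *: v) + (E h X - X - h *: g X) + h *: (g X - v).
  by apply/rowP => j; rewrite /= -/X !mxE -natr1; ring.
have := ler_normD ((X - x - (k%:R * h) *: v) + (E h X - X - h *: g X)) (h *: (g X - v)).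
have := ler_normD (X - x - (k%:R * h) *: v) (E h X - X - h *: g X).
have := Eg h01 (iter_step_in k h01 Mx); rewrite -/X.
have := IH (fun i ik => gk i (ltn_trans ik (ltnSn k))); rewrite -/X.
have : `|h *: (g X - v)| <= h * e by rewrite normrZ ger0_norm // ler_wpM2l // gk.
rewrite -natr1.
set a1 := `|_|; set a2 := `|_|; set a3 := `|_|; set a4 := `|_|; set a5 := `|_|.
move: a1 a2 a3 a4 a5 (k%:R) (C%:R) => a1 a2 a3 a4 a5 k' C'; lra.
Qed.

(** Rounding times down to multiples of [h] changes durations by at most [h], which [eta]
    absorbs. *)
Lemma euler_approx (h eta : R) x : 0 < h <= 1 -> h <= eta -> C%:R * h <= eta -> M x ->
  approx_solution g eta (fun t => iter (Num.truncn (t / h)) (E h) x).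
Proof.
move=> /andP[h0 h1] heta Ceta Mx s t v e s0 st v1 e0 ge.
have h01 : 0 <= h <= 1 by rewrite ltW.
have t0 := le_trans s0 st.
have sh0 : 0 <= s / h by rewrite divr_ge0 // ltW.
have th0 : 0 <= t / h by rewrite divr_ge0 // ltW.
set ks := Num.truncn (s / h); set kt := Num.truncn (t / h).
have kst : (ks <= kt)%N by apply: le_truncn; rewrite ler_pM2r // invr_gt0.
pose X := iter ks (E h) x.
have MX : M X by exact: iter_step_in.
have /andP[] := truncn_itv sh0; rewrite -/ks ler_pdivlMr // ltr_pdivrMr // => ks1 ks2.
have /andP[] := truncn_itv th0; rewrite -/kt ler_pdivlMr // ltr_pdivrMr // => kt1 kt2.
(* The vertex of index 0 is the value at [s] itself; the next ones are the values at multiples of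
   [h] between [s] and [t]. *)
have gX i : (i < kt - ks)%N -> `|g (iter i (E h) X) - v| <= e.
  case: i => [_|i ik]; first by have := ge s; rewrite lexx st -/ks; apply.
  have := ge ((i.+1 + ks)%:R * h); rewrite mulfK ?gt_eqF // natrK iterD; apply.
  have : (ks.+1)%:R <= (i.+1 + ks)%:R :> R by rewrite ler_nat addSn ltnS leq_addl.
  rewrite -(ler_pM2r h0) => a.
  have : (i.+1 + ks)%:R <= kt%:R :> R.
    by rewrite ler_nat addnC ltnW // -ltn_subRL.
  rewrite -(ler_pM2r h0) => b; apply/andP; split; first by apply: le_trans a; exact: ltW.
  exact: le_trans kt1.
have := iter_step_near h01 MX gX; rewrite -iterD subnK // natrB //.
set Y := iter kt _ _ => YX.
have -> : Y - X - (t - s) *: v =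
  (Y - X - ((kt%:R - ks%:R) * h) *: v) + ((kt%:R - ks%:R) * h - (t - s)) *: v.
  by apply/rowP => j; rewrite !mxE; ring.
rewrite (le_trans (ler_normD _ _)) // lerD //.
  apply: le_trans YX _; apply: ler_pM.
  - by rewrite mulr_ge0 ?(ltW h0) // subr_ge0 ler_nat.
  - by rewrite addr_ge0 // mulr_ge0 // ltW.
  - move: ks2 kt1; rewrite -natr1; lra.
  - lra.
rewrite normrZ; apply: (@le_trans _ _ (eta * 1)); last by rewrite mulr1.
apply: ler_pM => //; apply: le_trans heta; rewrite ler_norml.
by move: ks1 ks2 kt1 kt2; rewrite -!natr1 => *; apply/andP; split; lra.
Qed.

(** If it failed for all step sizes, polygons with steps going to 0 would miss the ball at time [T],
    whereas a limit of them is a solution, inside the open ball by [uniform_attraction]. *)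
Lemma euler_attraction (e : R) : 0 < e ->
  exists2 h, 0 <= h <= 1 & exists N : nat, forall x, K x -> `|iter N (E h) x - p| < e.
Proof.
move=> e0; apply: contrapT => noh.
have [T TP] := uniform_attraction e0.
(* Time [T] is then a whole number of steps, and both [h n] and [C * h n] are at most [1 / n.+1]. *)
pose h n : R := (C.+1 * n.+1)%:R^-1.
have h01 n : 0 < h n <= 1 by rewrite invr_gt0 ltr0n invf_le1 ?ltr0n // ler1n muln_gt0.
have /choice[x xP] : forall n, exists x,
    K x /\ ~ `|iter (T * (C.+1 * n.+1)) (E (h n)) x - p| < e.
  move=> n; apply: contrapT => /forallNP nox; apply: noh; exists (h n).
    by have /andP[/ltW -> ->] := h01 n.
  exists (T * (C.+1 * n.+1))%N => x Kx; apply: contrapT => xp; exact: (nox x).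
pose y n (t : R) := iter (Num.truncn (t / h n)) (E (h n)) (x n).
have [z [zsol Kz yz]] : exists z, [/\ solution M g +oo%E z, K (z 0) &
    forall (t e : R) N, 0 <= t -> 0 < e -> exists2 n, (N <= n)%N & `|y n t - z t| < e].
  apply: (@limit_solution R m M K g harmonic) => //.
  - exact: rescale_continuous.
  - by move=> u _; exact: rescale_le1.
  - by move=> n; rewrite /y mul0r truncn0; have [] := xP n.
  - move=> n t t0; apply: iter_step_in; last by apply: KM; have [] := xP n.
    by have /andP[/ltW -> ->] := h01 n.
  - move=> n; rewrite harmonic_ge0 /= invf_le1 ?ler1n //.
  - exact: cvg_harmonic.
  - move=> n; apply: euler_approx => //; last by apply: KM; have [] := xP n.
      by rewrite lef_pV2 ?posrE ?ltr0n // ler_nat leq_pmull.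
    by rewrite ler_pdivrMr ?ltr0n // mulrC ler_pdivlMr // -natrM ler_nat leq_mul.
have := TP z zsol Kz; rewrite -subr_gt0 => ep.
have [n _ yzn] := yz T%:R _ 0%N (ler0n _ _) ep.
have [_] := xP n; apply.
have <- : y n T%:R = iter (T * (C.+1 * n.+1)) (E (h n)) (x n).
  by rewrite /y /h invrK -natrM natrK.
rewrite -[y n _](subrK (z T%:R)) -addrA (le_lt_trans (ler_normD _ _)) //.
by move: yzn; rewrite ltrBrDr.
Qed.
End UniformAttraction.

(** * Unit dual quaternions *)

Section Dot.
Variables (R : realType) (n : nat).
Implicit Types (p q : 'rV[R]_n).

Definition dot p q : R := \sum_(i < n) p 0 i * q 0 i.
Definition enorm q : R := Num.sqrt (dot q q).

Lemma dotC p q : dot p q = dot q p.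
Proof. by apply: eq_bigr => i _; rewrite mulrC. Qed.

Lemma dotDl p p' q : dot (p + p') q = dot p q + dot p' q.
Proof. by rewrite -big_split; apply: eq_bigr => i _; rewrite mxE mulrDl. Qed.

Lemma dotZl a p q : dot (a *: p) q = a * dot p q.
Proof. by rewrite mulr_sumr; apply: eq_bigr => i _; rewrite mxE mulrA. Qed.

Lemma dotDr p q q' : dot p (q + q') = dot p q + dot p q'.
Proof. by rewrite dotC dotDl !(dotC p). Qed.

Lemma dotZr a p q : dot p (a *: q) = a * dot p q.
Proof. by rewrite dotC dotZl (dotC p). Qed.

Lemma dot0r p : dot p 0 = 0.
Proof. by rewrite /dot big1 // => i _; rewrite mxE mulr0. Qed.

Lemma dot_ge0 q : 0 <= dot q q.
Proof. by apply: sumr_ge0 => i _; rewrite -expr2 sqr_ge0. Qed.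

Lemma dot_sqr_ge q j : q 0 j ^+ 2 <= dot q q.
Proof.
rewrite /dot (bigD1 j) //= -expr2 lerDl.
by apply: sumr_ge0 => i _; rewrite -expr2 sqr_ge0.
Qed.

Lemma norm_dot_le p q : `|dot p q| <= n%:R * (`|p| * `|q|).
Proof.
apply: le_trans (ler_norm_sum _ _ _) _.
have -> : n%:R * (`|p| * `|q|) = \sum_(i < n) (`|p| * `|q|).
  by rewrite sumr_const card_ord mulr_natl.
apply: ler_sum => i _.
by rewrite normrM ler_pM // coord_le_norm.
Qed.

Lemma norm_le_enorm q : `|q| <= enorm q.
Proof.
apply/rV_norm_leP => [|j]; first exact: sqrtr_ge0.
by rewrite -sqrtr_sqr ler_wsqrtr // dot_sqr_ge.
Qed.

Lemma enorm_sqr q : enorm q ^+ 2 = dot q q.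
Proof. by rewrite sqr_sqrtr // dot_ge0. Qed.

Lemma cvg_rV (T : Type) (F : set_system T) (u : T -> 'rV[R]_n) (l : 'rV[R]_n) :
  Filter F -> (forall j, u x 0 j @[x --> F] --> l 0 j) -> u x @[x --> F] --> l.
Proof.
move=> FF ul; apply/cvgrPdist_lt => e e0.
have : \forall x \near F, forall j, `|l 0 j - u x 0 j| < e.
  by apply: filter_forall => j; have /cvgrPdist_lt/(_ e e0) := ul j.
by apply: filterS => x ux; apply/rV_norm_ltP => // j; rewrite !mxE.
Qed.

Lemma cvg_coord (T : Type) (F : set_system T) (u : T -> 'rV[R]_n) (l : 'rV[R]_n) j :
  Filter F -> u x @[x --> F] --> l -> u x 0 j @[x --> F] --> l 0 j.
Proof.
move=> FF ul; apply: (@cvg_comp _ _ _ u (fun w : 'rV[R]_n => w 0 j)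
  F (nbhs l) (nbhs (l 0 j))) => //.
exact: coord_continuous.
Qed.

Lemma cvg_dot (T : Type) (F : set_system T) (u v : T -> 'rV[R]_n) (l k : 'rV[R]_n) :
  Filter F -> u x @[x --> F] --> l -> v x @[x --> F] --> k ->
  dot (u x) (v x) @[x --> F] --> dot l k.
Proof.
move=> FF ul vk; apply: cvg_big => [|i _]; first exact: add_continuous.
by apply: cvgM; exact: cvg_coord.
Qed.

Lemma is_derive_dot (u v : R -> 'rV[R]_n) (t : R) (u' v' : 'rV[R]_n) :
  is_derive t 1 u u' -> is_derive t 1 v v' ->
  is_derive t 1 (fun s => dot (u s) (v s)) (dot u' (v t) + dot (u t) v').
Proof.
move=> /is_derive_rVP du /is_derive_rVP dv.
have -> : (fun s => dot (u s) (v s)) = \sum_(i < n) (fun s => u s 0 i * v s 0 i).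
  by apply/funext => s; rewrite fct_sumE.
rewrite /dot -big_split; apply: is_derive_sum => i.
have := @is_deriveM _ _ _ _ _ _ _ _ (du i) (dv i).
by rewrite addrC /GRing.scale /= [v t _ _ * _]mulrC.
Qed.
End Dot.

Section UnitDualQuaternions.
Variable R : realType.
Implicit Types (x v : dual_quaternion R) (q : quaternion R).
Local Notation M := (@unit_dual_quaternions R).

Lemma dot4 (p q : quaternion R) :
  dot p q = p 0 0 * q 0 0 + p 0 1 * q 0 1 + p 0 2 * q 0 2 + p 0 3 * q 0 3.
Proof.
rewrite /dot !big_ord_recl big_ord0 addr0 !addrA.
have -> : lift ord0 ord0 = 1 :> 'I_4 by exact: val_inj.
have -> : lift ord0 (lift ord0 ord0) = 2 :> 'I_4 by exact: val_inj.
by have -> : lift ord0 (lift ord0 (lift ord0 ord0)) = 3 :> 'I_4 by exact: val_inj.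
Qed.

(** [q q'^* + q' q^*] is the sum of a quaternion and its conjugate, hence twice the real part of
    [q q'^*], that is, twice the dot product. *)
Lemma udqP x : M x <->
  dot (primal x) (primal x) = 1 /\ dot (primal x) (dual_part x) = 0.
Proof.
have quat0 (a b c d : R) : quat a b c d 0 0 = a by rewrite mxE.
have quat1 (a b c d : R) : quat a b c d 0 1 = b by rewrite mxE.
have quat2 (a b c d : R) : quat a b c d 0 2 = c by rewrite mxE.
have quat3 (a b c d : R) : quat a b c d 0 3 = d by rewrite mxE.
have quatE := (quat0, quat1, quat2, quat3).
set q := primal x; set q' := dual_part x.
have qq : qmul q (qconj q) 0 0 = dot q q.
  by rewrite /qmul /qconj !quatE dot4; ring.
have qq' : qmul q (qconj q') + qmul q' (qconj q) = quat (dot q q' + dot q q') 0 0 0.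
  apply/rowP => j; rewrite /qmul /qconj !quatE [LHS]mxE dot4 !mxE.
  by case: j => [[|[|[|[|//]]]]] ? /=; ring.
rewrite /unit_dual_quaternions /mkset -/q -/q' /qnorm qq qq'; split=> [[q1 d0]|[-> ->]].
  split; first by rewrite -[LHS]sqr_sqrtr ?dot_ge0 // q1 expr1n.
  have := congr1 (fun r : quaternion R => r 0 0) d0.
  by rewrite quat0 mxE; lra.
rewrite sqrtr1; split=> //; apply/rowP => j; rewrite !mxE addr0.
by case: j => [[|[|[|[|//]]]]].
Qed.

Lemma primalE x j : primal x 0 j = x 0 (lshift 4 j).
Proof. by rewrite mxE. Qed.

Lemma dual_partE x j : dual_part x 0 j = x 0 (rshift 4 j).
Proof. by rewrite mxE. Qed.

Lemma cvg_primal (T : Type) (F : set_system T) (u : T -> dual_quaternion R) x :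
  Filter F -> u t @[t --> F] --> x -> primal (u t) @[t --> F] --> primal x.
Proof.
move=> FF ux; apply: cvg_rV => j; rewrite primalE.
by under eq_fun do rewrite primalE; exact: cvg_coord.
Qed.

Lemma cvg_dual_part (T : Type) (F : set_system T) (u : T -> dual_quaternion R) x :
  Filter F -> u t @[t --> F] --> x -> dual_part (u t) @[t --> F] --> dual_part x.
Proof.
move=> FF ux; apply: cvg_rV => j; rewrite dual_partE.
by under eq_fun do rewrite dual_partE; exact: cvg_coord.
Qed.

Lemma cvg_row_mx (T : Type) (F : set_system T) (u v : T -> quaternion R) (q q' : quaternion R) :
  Filter F -> u t @[t --> F] --> q -> v t @[t --> F] --> q' ->
  row_mx (u t) (v t) @[t --> F] --> row_mx q q'.
Proof.
move=> FF uq vq; apply: cvg_rV => j; rewrite -[j]splitK; case: (fintype.split j) => i /=.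
  by rewrite row_mxEl; under eq_fun do rewrite row_mxEl; exact: cvg_coord.
by rewrite row_mxEr; under eq_fun do rewrite row_mxEr; exact: cvg_coord.
Qed.

Lemma norm_primal x : `|primal x| <= `|x|.
Proof. by apply/rV_norm_leP => // j; rewrite primalE coord_le_norm. Qed.

Lemma norm_dual_part x : `|dual_part x| <= `|x|.
Proof. by apply/rV_norm_leP => // j; rewrite dual_partE coord_le_norm. Qed.

Lemma norm_row_mx (q q' : quaternion R) c : 0 <= c -> `|q| <= c -> `|q'| <= c ->
  `|(row_mx q q' : dual_quaternion R)| <= c.
Proof.
move=> c0 qc qc'; apply/rV_norm_leP => // j.
rewrite -[j]splitK; case: (fintype.split j) => i /=.
  by rewrite row_mxEl (le_trans (coord_le_norm _ _)).
by rewrite row_mxEr (le_trans (coord_le_norm _ _)).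
Qed.

Lemma closed_udq : closed M.
Proof.
rewrite (_ : M = (fun x => dot (primal x) (primal x)) @^-1` [set 1] `&`
                 (fun x => dot (primal x) (dual_part x)) @^-1` [set 0]); last first.
  by apply/seteqP; split=> x /udqP.
have c1 : closed [set (1 : R)] by exact: closed_eq.
have c0 : closed [set (0 : R)] by exact: closed_eq.
have px x := @cvg_primal _ (nbhs x) id x (nbhs_filter x) cvg_id.
have dx x := @cvg_dual_part _ (nbhs x) id x (nbhs_filter x) cvg_id.
apply: closedI; apply: preimage_closed => // x _.
  exact: (cvg_dot _ (px x) (px x)).
exact: (cvg_dot _ (px x) (dx x)).
Qed.

Lemma is_derive_primal (c : R -> dual_quaternion R) (t : R) v :
  is_derive t 1 c v -> is_derive t 1 (fun s => primal (c s)) (primal v).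
Proof.
move=> /is_derive_rVP cv; apply/is_derive_rVP => j; rewrite primalE.
by under eq_fun do rewrite primalE; exact: cv.
Qed.

Lemma is_derive_dual_part (c : R -> dual_quaternion R) (t : R) v :
  is_derive t 1 c v -> is_derive t 1 (fun s => dual_part (c s)) (dual_part v).
Proof.
move=> /is_derive_rVP cv; apply/is_derive_rVP => j; rewrite dual_partE.
by under eq_fun do rewrite dual_partE; exact: cv.
Qed.

(** The two equations of [udqP] are differentiated along a curve in [M]. *)
Lemma tangent_udq x v : tangent_space M x v ->
  dot (primal x) (primal v) = 0 /\
  dot (primal v) (dual_part x) + dot (primal x) (dual_part v) = 0.
Proof.
move=> [e [c [e0 cM cd c0 cv]]].
have c'v : is_derive (0 : R) 1 c v.
  by split; [apply: (cd 0%N 0); rewrite normr0|rewrite -derive1E].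
have near_M : \forall t \near (0 : R), M (c t).
  apply/nbhs_ballP; exists e => // t t0; apply: cM.
  have {}t0 : `|0 - t| < e by exact: t0.
  by rewrite sub0r normrN in t0.
have is_derive_eq0 (F : R -> R) a l : (forall t, M (c t) -> F t = a) ->
    is_derive (0 : R) 1 F l -> l = 0.
  move=> Fa [_ <-].
  have Fcst : \forall t \near (0 : R), cst a t = F t.
    by apply: filterS near_M => t /Fa.
  by have [] := near_eq_is_derive Fcst (is_derive_cst a (0 : R) (1 : R)).
have dp := is_derive_primal c'v; have dd := is_derive_dual_part c'v.
have := is_derive_dot dp dp; have := is_derive_dot dp dd; rewrite c0 => d1 d2.
split; last by apply: (is_derive_eq0 _ 0 _ _ d1) => t /udqP[].
have dd0 : dot (primal v) (primal x) + dot (primal x) (primal v) = 0.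
  by apply: (is_derive_eq0 _ 1 _ _ d2) => t /udqP[].
by move: dd0; rewrite dotC; lra.
Qed.

(** A Gram-Schmidt step on the pair, without normalizing the second vector: a continuous retraction
    onto [M] where the primal part is nonzero. *)
Definition udq_proj x : dual_quaternion R :=
  row_mx ((enorm (primal x))^-1 *: primal x)
    (dual_part x - (dot (primal x) (dual_part x) / dot (primal x) (primal x)) *: primal x).

Lemma primal_row_mx (q q' : quaternion R) : primal (row_mx q q') = q.
Proof. exact: row_mxKl. Qed.

Lemma dual_part_row_mx (q q' : quaternion R) : dual_part (row_mx q q') = q'.
Proof. exact: row_mxKr. Qed.

Lemma dot_normalize n (q : 'rV[R]_n) : 0 < dot q q ->
  dot ((enorm q)^-1 *: q) ((enorm q)^-1 *: q) = 1.
Proof.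
move=> q0; rewrite dotZl dotZr -(enorm_sqr q) mulrA -expr2 -exprMn mulVf ?expr1n //.
by rewrite gt_eqF // sqrtr_gt0.
Qed.

Lemma udq_proj_in x : 0 < dot (primal x) (primal x) -> M (udq_proj x).
Proof.
move=> x0; apply/udqP; rewrite primal_row_mx dual_part_row_mx; split.
  exact: dot_normalize.
rewrite dotZl dotDr -scaleNr dotZr mulNr divfK ?subrr ?mulr0 //.
by rewrite gt_eqF.
Qed.

Lemma udq_proj_id x : M x -> udq_proj x = x.
Proof.
move=> /udqP[x1 x0]; rewrite /udq_proj /enorm x1 x0 sqrtr1 invr1 scale1r mul0r scale0r subr0.
exact: hsubmxK.
Qed.

Lemma cvg_udq_proj (T : Type) (F : set_system T) (u : T -> dual_quaternion R) x :
  Filter F -> 0 < dot (primal x) (primal x) ->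
  u t @[t --> F] --> x -> udq_proj (u t) @[t --> F] --> udq_proj x.
Proof.
move=> FF x0 ux; have px := cvg_primal FF ux; have dx := cvg_dual_part FF ux.
have nx : enorm (primal (u t)) @[t --> F] --> enorm (primal x).
  apply: (cvg_comp _ _ (cvg_dot FF px px)); exact: sqrt_continuous.
have nV : (enorm (primal (u t)))^-1 @[t --> F] --> (enorm (primal x))^-1.
  by apply: cvgV => //; rewrite gt_eqF // sqrtr_gt0.
apply: cvg_row_mx; first exact: (cvgZ nV px).
have dV := cvgV (lt0r_neq0 x0) (cvg_dot FF px px).
by apply: cvgB; [exact: dx|apply: cvgZ; [apply: cvgM; [exact: cvg_dot|exact: dV]|exact: px]].
Qed.

(** * Projected Euler steps *)

Definition euler_step (g : dual_quaternion R -> dual_quaternion R) (h : R) x :=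
  udq_proj (x + h *: g x).

Section EulerStep.
Variable g : dual_quaternion R -> dual_quaternion R.
Hypothesis gtan : forall x, M x -> dot (primal x) (primal (g x)) = 0 /\
  dot (primal (g x)) (dual_part x) + dot (primal x) (dual_part (g x)) = 0.
Hypothesis g1 : forall x, M x -> `|g x| <= 1.

Let primalD x y : primal (x + y) = primal x + primal y.
Proof. exact: linearD. Qed.
Let primalZ a x : primal (a *: x) = a *: primal x.
Proof. exact: linearZ. Qed.
Let dual_partD x y : dual_part (x + y) = dual_part x + dual_part y.
Proof. exact: linearD. Qed.
Let dual_partZ a x : dual_part (a *: x) = a *: dual_part x.
Proof. exact: linearZ. Qed.

(** Tangency cancels the first-order term. The primal part thus has Euclidean norm at least 1 before
    projection, which keeps [udq_proj] away from its singularity. *)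
Lemma euler_dot_primal h x : M x ->
  dot (primal (x + h *: g x)) (primal (x + h *: g x)) =
  1 + h ^+ 2 * dot (primal (g x)) (primal (g x)).
Proof.
move=> Mx; have [x1 _] := (udqP x).1 Mx; have [xg _] := gtan Mx.
rewrite primalD primalZ !(dotDl, dotDr, dotZl, dotZr) (dotC (primal (g x))) xg x1.
ring.
Qed.

Lemma euler_dot_dual h x : M x ->
  dot (primal (x + h *: g x)) (dual_part (x + h *: g x)) =
  h ^+ 2 * dot (primal (g x)) (dual_part (g x)).
Proof.
move=> Mx; have [_ x0] := (udqP x).1 Mx; have [_ xg] := gtan Mx.
rewrite primalD primalZ dual_partD dual_partZ !(dotDl, dotDr, dotZl, dotZr) x0.
have -> : dot (primal x) (dual_part (g x)) = - dot (primal (g x)) (dual_part x).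
  by apply/eqP; rewrite -addr_eq0 addrC xg.
set a := dot _ (dual_part x); set b := dot _ _; ring.
Qed.

Lemma euler_dot_gt0 h x : M x ->
  0 < dot (primal (x + h *: g x)) (primal (x + h *: g x)).
Proof.
move=> Mx; rewrite euler_dot_primal // ltr_wpDr // mulr_ge0 ?sqr_ge0 //.
exact: dot_ge0.
Qed.

Lemma euler_step_in h x : M x -> M (euler_step g h x).
Proof. by move=> Mx; apply/udq_proj_in/euler_dot_gt0. Qed.

(** The projection changes each half by a multiple of [primal y] with coefficient at most
    [4 * h ^ 2], and [primal y] has norm at most 2, hence the 8. *)
Lemma euler_step_near h x : 0 <= h <= 1 -> M x ->
  `|euler_step g h x - x - h *: g x| <= 8%:R * h ^+ 2.
Proof.
move=> /andP[h0 h1] Mx; have [x1 _] := (udqP x).1 Mx.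
set y := x + h *: g x; set D := dot (primal y) (primal y).
(* The 4 is the dimension in [norm_dot_le]. *)
have gx4 : dot (primal (g x)) (primal (g x)) <= 4.
  apply: le_trans (ler_norm _) _; apply: le_trans (norm_dot_le _ _) _.
  have pg : `|primal (g x)| <= 1 by apply: le_trans (g1 Mx); exact: norm_primal.
  by rewrite -[leRHS]mulr1 ler_wpM2l // -[leRHS]mulr1 ler_pM.
have gd4 : `|dot (primal (g x)) (dual_part (g x))| <= 4.
  apply: le_trans (norm_dot_le _ _) _.
  have pg : `|primal (g x)| <= 1 by apply: le_trans (g1 Mx); exact: norm_primal.
  have dg : `|dual_part (g x)| <= 1 by apply: le_trans (g1 Mx); exact: norm_dual_part.
  by rewrite -[leRHS]mulr1 ler_wpM2l // -[leRHS]mulr1 ler_pM.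
have DE : D = 1 + h ^+ 2 * dot (primal (g x)) (primal (g x)) by exact: euler_dot_primal.
have h2 : 0 <= h ^+ 2 by exact: sqr_ge0.
have D1 : 1 <= D by rewrite DE lerDl mulr_ge0 // dot_ge0.
have D4 : D - 1 <= 4 * h ^+ 2 by rewrite DE addrAC subrr add0r mulrC ler_wpM2r.
have D0 : 0 < D by exact: lt_le_trans D1.
have y2 : `|primal y| <= 2.
  rewrite primalD primalZ (le_trans (ler_normD _ _)) // (_ : 2 = 1 + 1) // lerD //.
    by apply: le_trans (norm_le_enorm _) _; rewrite /enorm x1 sqrtr1.
  rewrite normrZ ger0_norm // -[leRHS]mulr1 ler_pM //.
  by apply: le_trans (g1 Mx); exact: norm_primal.
have s1 : 1 <= enorm (primal y) by rewrite -sqrtr1 ler_wsqrtr.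
have sE := enorm_sqr (primal y); rewrite -/D in sE.
have -> : euler_step g h x - x - h *: g x =
    row_mx (((enorm (primal y))^-1 - 1) *: primal y)
           (- (dot (primal y) (dual_part y) / D) *: primal y).
  rewrite -addrA -opprD -/y -[y in _ - y]hsubmxK /euler_step -/y /udq_proj.
  rewrite opp_row_mx add_row_mx -/D; congr row_mx; first by rewrite scalerBl scale1r.
  by rewrite addrAC subrr add0r scaleNr.
have bound c : `|c| <= 4 * h ^+ 2 -> `|c *: primal y| <= 8 * h ^+ 2.
  move=> ch; rewrite normrZ (_ : 8 * h ^+ 2 = 4 * h ^+ 2 * 2); last by ring.
  by rewrite ler_pM.
apply: norm_row_mx; [by rewrite mulr_ge0|apply: bound|apply: bound].
  (* For [s >= 1], [1 - s^-1 <= s ^ 2 - 1]. *)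
  rewrite distrC ger0_norm ?subr_ge0 ?invf_le1 ?(lt_le_trans ltr01) //.
  apply: le_trans D4; rewrite -sE; move: s1; set s := enorm _ => s1.
  have : s * s^-1 = 1 by rewrite divff // gt_eqF // (lt_le_trans ltr01).
  have : 0 <= s^-1 by rewrite invr_ge0 (le_trans ler01).
  nra.
rewrite normrN normrM normfV (gtr0_norm D0) ler_pdivrMr // euler_dot_dual // normrM.
rewrite (ger0_norm h2) mulrC -[leLHS]mulr1 ler_pM ?mulr_ge0 //.
by rewrite ler_wpM2r.
Qed.
End EulerStep.
End UnitDualQuaternions.

(** * Euler polygons as a homotopy *)

(** This is [max(0, min(1, r))], in a form whose continuity follows from that of the absolute
    value. *)
Definition clamp (R : realType) (r : R) : R := (1 + `|r| - `|r - 1|) / 2.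

Lemma clamp_itv (R : realType) (r : R) : 0 <= clamp r <= 1.
Proof.
rewrite /clamp; have [?|?] := ger0P r; have [?|?] := ger0P (r - 1);
  by apply/andP; split; lra.
Qed.

Lemma clamp0 (R : realType) (r : R) : r <= 0 -> clamp r = 0.
Proof. by move=> r0; rewrite /clamp !ler0_norm; lra. Qed.

Lemma clamp1 (R : realType) (r : R) : 1 <= r -> clamp r = 1.
Proof. by move=> r1; rewrite /clamp !ger0_norm; lra. Qed.

Lemma continuous_clamp (R : realType) : continuous (@clamp R).
Proof.
move=> r; apply: cvgM; last exact: cvg_cst.
apply: cvgB; first by apply: cvgD; [exact: cvg_cst|apply: cvg_norm; exact: cvg_id].
by apply: cvg_norm; apply: cvgB; [exact: cvg_id|exact: cvg_cst].
Qed.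

Lemma cvg_clamp (R : realType) (T : Type) (F : set_system T) (u : T -> R) (a b l : R) :
  Filter F -> u x @[x --> F] --> l -> clamp (a + b * u x) @[x --> F] --> clamp (a + b * l).
Proof.
move=> FF ul; have abl : a + b * u x @[x --> F] --> a + b * l.
  by apply: cvgD; [exact: cvg_cst|apply: cvgM; [exact: cvg_cst|exact: ul]].
exact: (cvg_comp _ _ abl (@continuous_clamp R _)).
Qed.

Lemma rescale_tangent (R : realType) (f : dual_quaternion R -> dual_quaternion R) :
  (forall x, unit_dual_quaternions x ->
    tangent_space (@unit_dual_quaternions R) x (f x)) ->
  forall x, unit_dual_quaternions x ->
    dot (primal x) (primal (rescale f x)) = 0 /\
    dot (primal (rescale f x)) (dual_part x) +
    dot (primal x) (dual_part (rescale f x)) = 0.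
Proof.
move=> ftan x Mx; have [e1 e2] := tangent_udq (ftan x Mx).
have pZ a (v : dual_quaternion R) : primal (a *: v) = a *: primal v by exact: linearZ.
have dZ a (v : dual_quaternion R) : dual_part (a *: v) = a *: dual_part v by exact: linearZ.
by rewrite /rescale pZ dZ dotZl !dotZr e1 mulr0 -mulrDr e2 mulr0.
Qed.

(* As |w| decreases from 1 to 1/2, the step size grows from 0 to h, which deforms
   the identity of S^3 into a map close to p; the segment to p is followed
   while |w| decreases from 1/2 to 3/8. *)
Lemma euler_not_near_constant (R : realType) (f : dual_quaternion R -> dual_quaternion R)
    (p : dual_quaternion R) (h : R) (N : nat) :
  continuous_vector_field (@unit_dual_quaternions R) f ->
  unit_dual_quaternions p ->
  ~ (forall x, unit_dual_quaternions x -> `|x| <= 1 ->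
       `|iter N (euler_step (rescale f) h) x - p| < 1 / 4).
Proof.
move=> [fc ftan] Mp near_p.
set M := @unit_dual_quaternions R in fc ftan Mp near_p.
set g := rescale f in near_p.
have gc : {within M, continuous g} by exact: rescale_continuous.
have gtan := rescale_tangent ftan; rewrite -/g -/M in gtan.
pose rad := @enorm R 4.
have radc : continuous rad.
  move=> w; have idw := @cvg_id _ (nbhs w).
  apply: (cvg_comp _ _ (cvg_dot (nbhs_filter w) idw idw)); exact: sqrt_continuous.
pose Phi k (w : 'rV[R]_4) : dual_quaternion R :=
  iter k (euler_step g (clamp (2 + - 2 * rad w) * h)) (row_mx ((rad w)^-1 *: w) 0).
have sphere (w : quaternion R) : 0 < rad w -> M (row_mx ((rad w)^-1 *: w) 0) /\
    `|(row_mx ((rad w)^-1 *: w) 0 : dual_quaternion R)| <= 1.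
  move=> w0; have u1 : dot ((rad w)^-1 *: w) ((rad w)^-1 *: w) = 1.
    by apply: dot_normalize; rewrite -sqrtr_gt0.
  split; first by apply/udqP; rewrite primal_row_mx dual_part_row_mx dot0r.
  apply: norm_row_mx; rewrite ?normr0 //.
  by apply: le_trans (norm_le_enorm _) _; rewrite /enorm u1 sqrtr1.
have PhiM k w : 0 < rad w -> M (Phi k w).
  move=> w0; rewrite /Phi; elim: k => [|k IH] /=; first by have [] := sphere w w0.
  exact: (euler_step_in gtan).
have Phic k (w : 'rV[R]_4) : 0 < rad w -> Phi k x @[x --> w] --> Phi k w.
  move=> w0; elim: k => [|k IH].
    have c0 : (fun=> 0 : 'rV[R]_4) x @[x --> w] --> (0 : 'rV[R]_4).
      exact (@cvg_cst _ (0 : 'rV[R]_4) _ (nbhs w) (nbhs_filter w)).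
    have rV : (rad x)^-1 @[x --> w] --> (rad w)^-1.
      exact: (cvgV (lt0r_neq0 w0) (radc w)).
    have wc : (rad x)^-1 *: x @[x --> w] --> (rad w)^-1 *: w.
      have idw := @cvg_id _ (nbhs w).
      exact (cvgZ rV idw).
    exact: (cvg_row_mx (nbhs_filter w) wc c0).
  (* [g] is continuous only within [M], but near [w] the radius stays positive and the polygons stay
     in [M]. *)
  have gPhi : g (Phi k x) @[x --> w] --> g (Phi k w).
    apply/(@cvgrPdist_lt _ _ _ (nbhs w) (nbhs_filter w)) => e e0.
    have [d d0 dP] := (within_continuous_epsP M g).1 gc _ (PhiM k w w0) e e0.
    have Pd := (@cvgrPdist_lt _ _ _ (nbhs w) (nbhs_filter w) _ _).1 IH d d0.
    have rpos : \forall x \near w, 0 < rad x by exact: (radc w _ (lt_nbhsr w0)).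
    apply: filterS (filterI Pd rpos) => x [xd x0]; rewrite distrC; apply: dP.
      exact: PhiM.
    by rewrite distrC.
  have lc : clamp (2 + - 2 * rad x) * h @[x --> w] --> clamp (2 + - 2 * rad w) * h.
    have Fh := @cvg_cst R (h : R) _ (nbhs w) (nbhs_filter w).
    exact (cvgM (cvg_clamp (a := 2) (b := - 2) (nbhs_filter w) (radc w)) Fh).
  have D0 := euler_dot_gt0 gtan (clamp (2 + - 2 * rad w) * h) (PhiM k w w0).
  exact (cvg_udq_proj (nbhs_filter w) D0 (cvgD IH (cvgZ lc gPhi))).
pose G (w : 'rV[R]_4) : 'rV[R]_4 :=
  primal p + clamp (- 3 + 8 * rad w) *: (primal (Phi N w) - primal p).
have Gc : continuous G.
  (* [Phi] may be discontinuous at the origin, but [G] is constant on the ball of radius [3 / 8]. *)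
  move=> w; have [w38|w38] := ltP (rad w) (3 / 8).
    have near0 : \forall x \near w, primal p = G x.
      have : \forall x \near w, rad x < 3 / 8 by exact: (radc w _ (lt_nbhsl w38)).
      apply: filterS => x x38; rewrite /G clamp0 ?scale0r ?addr0 //; lra.
    have Gw : G w = primal p by rewrite /G clamp0 ?scale0r ?addr0 //; lra.
    have cp := @cvg_cst _ (primal p) _ (nbhs w) (nbhs_filter w).
    rewrite /continuous_at Gw.
    exact (cvg_trans (@near_eq_cvg _ _ _ (nbhs_filter w) (fun=> primal p) G near0) cp).
  have w0 : 0 < rad w by lra.
  have cp := @cvg_cst _ (primal p) _ (nbhs w) (nbhs_filter w).
  have pPhi := cvg_primal (nbhs_filter w) (Phic N w w0).
  exact (cvgD cp (cvgZ (cvg_clamp (a := - 3) (b := 8) (nbhs_filter w) (radc w)) (cvgB pPhi cp))).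
have p1 : dot (primal p) (primal p) = 1 by have [] := (udqP p).1 Mp.
(* The step size is 0 there, and [udq_proj] fixes the points of [M]. *)
have Gface w : 1 <= rad w -> G w = (rad w)^-1 *: w.
  move=> w1; rewrite /G clamp1; last by lra.
  rewrite scale1r addrC subrK /Phi clamp0; last by lra.
  have w0 : 0 < rad w by lra.
  have [Mw _] := sphere w w0.
  have -> : iter N (euler_step g (0 * h)) (row_mx ((rad w)^-1 *: w) 0) =
            (row_mx ((rad w)^-1 *: w) 0 : dual_quaternion R).
    elim: (N) => //= k ->.
    by rewrite /euler_step mul0r scale0r addr0 udq_proj_id.
  exact: primal_row_mx.
have rad_ge (w : quaternion R) j : `|w 0 j| = 1 -> 1 <= rad w.
  move=> wj; rewrite -wj; apply: le_trans (norm_le_enorm w); exact: coord_le_norm.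
have [w _ Gw] : exists2 w : quaternion R, `|w| <= 1 & G w = 0.
  apply: poincare_miranda => // x j _ xj.
    have x1 : 1 <= rad x by apply: (rad_ge x j); rewrite xj normrN1.
    by rewrite Gface // mxE xj mulrN1 oppr_le0 invr_ge0; lra.
  have x1 : 1 <= rad x by apply: (rad_ge x j); rewrite xj normr1.
  by rewrite Gface // mxE xj mulr1 invr_ge0; lra.
(* For [rad w >= 1 / 2], [G w] is the primal part of a point of [M], a unit quaternion. *)
have [w12|w12] := leP (1 / 2) (rad w).
  have w0 : 0 < rad w by lra.
  have := ((udqP _).1 (PhiM N w w0)).1.
  have := Gw; rewrite /G clamp1; last by lra.
  rewrite scale1r addrC subrK => ->; rewrite dot0r => /eqP.
  by rewrite eq_sym oner_eq0.
have pG : primal p = - (clamp (- 3 + 8 * rad w) *: (primal (Phi N w) - primal p)).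
  by apply/eqP; rewrite -addr_eq0; apply/eqP.
(* Below radius [1 / 2] the full step [h] is used, so [Phi] ends within [1 / 4] of [p], and a zero
   of [G] makes [primal p] as small. *)
have p14 : `|primal p| <= 1 / 4.
  rewrite pG normrN normrZ.
  have [w38|w38] := leP (rad w) (3 / 8).
    rewrite clamp0 ?normr0 ?mul0r //; lra.
  have w0 : 0 < rad w by lra.
  have /andP[c0 c1] := clamp_itv (- 3 + 8 * rad w).
  rewrite (ger0_norm c0) -[leRHS]mul1r ler_pM //.
  have [Mw w1] := sphere w w0.
  have := near_p _ Mw w1.
  have -> : iter N (euler_step g h) (row_mx ((rad w)^-1 *: w) 0) = Phi N w.
    by rewrite /Phi clamp1 ?mul1r //; lra.
  move=> /ltW; apply: le_trans.
  have <- : primal (Phi N w - p) = primal (Phi N w) - primal p by exact: linearB.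
  exact: norm_primal.
(* In dimension 4 this yields [1 <= 4 * (1 / 16)]. *)
have := norm_dot_le (primal p) (primal p); rewrite p1 normr1.
have : `|primal p| * `|primal p| <= 1 / 4 * (1 / 4) by rewrite ler_pM.
lra.
Qed.

Theorem theorem1 (R : realType) (f : dual_quaternion R -> dual_quaternion R)
    (hf : continuous_vector_field (@unit_dual_quaternions R) f) :
  ~ (exists p : dual_quaternion R,
       equilibrium (@unit_dual_quaternions R) f p /\
       globally_asymptotically_stable (@unit_dual_quaternions R) f p).
Proof.
move=> [p [[Mp _] [stable attractive]]]; have [fc ftan] := hf.
set M := @unit_dual_quaternions R in fc ftan Mp stable attractive.
(* [M] is not compact; [K] contains the pairs [(u, 0)] with [u] a unit quaternion, from which the
   polygons start. *)
pose K : set (dual_quaternion R) := [set x | `|x| <= 1] `&` M.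
have Kc : compact K.
  by apply: compact_closedI; [exact: compact_closed_ball_rV|exact: closed_udq].
have KM : K `<=` M by move=> x [].
have g_le1 x : M x -> `|rescale f x| <= 1 by move=> _; exact: rescale_le1.
have [h _ [N near_p]] := @euler_attraction R _ M K f p (@closed_udq R) fc stable
  attractive Kc KM (euler_step (rescale f)) 8
  (fun h x _ => euler_step_in (rescale_tangent ftan) h (x := x))
  (fun h x => euler_step_near (rescale_tangent ftan) g_le1 (h := h) (x := x))
  (1 / 4) ltac:(lra).
apply: (euler_not_near_constant hf Mp) => x Mx x1.
by apply: near_p; split.
Qed.
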